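(* A path $\rho$ in $\mathcal S$ (of an ABC process) is just iff $\rho=\widehat\pi$ for some path $\pi$ in $\mathcal U$ that satisfies the LTL formula $\mathbf{F}\mathbf{G}\,\mathit{en}(\nu)\Rightarrow\mathbf{G}\mathbf{F}\,\nu$ for every abstract transition $\nu$ whose label $\ell(\nu)\in Act$ is a non-blocking action (i.e. $\ell(\nu)\in\mathcal B!\cup\{\tau\}$).
   Context: ABC: sets $\mathcal A$ (agent identifiers), $\mathcal B$ (broadcast names), $\mathcal C$ (handshake names); $H=\mathcal C\cup\{\bar c\mid c\in\mathcal C\}$, $\bar{\bar c}=c$, $\bar Z=\{\bar c\mid c\in Z\}$; $Act=\mathcal B!\cup\mathcal B?\cup H\cup\{\tau\}$ with $\mathcal B!=\{b!\}$, $\mathcal B?=\{b?\}$. Non-blocking actions are $\tau$ and the broadcasts $b!$. A relabelling $f$ maps $\mathcal B\to\mathcal B$, $\mathcal C\to\mathcal C$, extended by $f(\bar c)=\overline{f(c)}$, $f(b\sharp)=f(b)\sharp$, $f(\tau)=\tau$. Expressions: $0$, $\alpha.E$, $E+F$, $E|F$, $E\backslash c$ ($c\in H$), $E[f]$, $A\in\mathcal A$ with guarded defining equations $A\stackrel{def}{=}P$. Transitions are given by the rules (with $\eta\in H\cup\{\tau\}$): (Act) $\alpha.E\xrightarrow{\alpha}E$; (Sum-l/r) a transition of $E$ (resp. $F$) is a transition of $E+F$; (Par-l/r) $E\xrightarrow{\eta}E'$ gives $E|F\xrightarrow{\eta}E'|F$, and symmetrically; (Comm) $E\xrightarrow{c}E'$,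 $F\xrightarrow{\bar c}F'$ give $E|F\xrightarrow{\tau}E'|F'$; (Bro-l) $E\xrightarrow{b\sharp_1}E'$ ($\sharp_1\in\{!,?\}$) and $F$ has no $b?$-transition give $E|F\xrightarrow{b\sharp_1}E'|F$; (Bro-r) symmetric; (Bro-c) $E\xrightarrow{b\sharp_1}E'$, $F\xrightarrow{b\sharp_2}F'$ give $E|F\xrightarrow{b(\sharp_1\circ\sharp_2)}E'|F'$ with $!\circ?=?\circ!=!$, $?\circ?=?$, $!\circ!$ undefined; (Rel) $E\xrightarrow{\ell}E'$ gives $E[f]\xrightarrow{f(\ell)}E'[f]$; (Res) $E\xrightarrow{\ell}E'$, $\ell\notin\{c,\bar c\}$ give $E\backslash c\xrightarrow{\ell}E'\backslash c$; (Rec) $P\xrightarrow{\ell}E'$, $A\stackrel{def}{=}P$ give $A\xrightarrow{\ell}E'$. $\mathcal S$: states are the expressions and the transitions $t=(P,\alpha,Q)$; edges $P\to t\to Q$. Paths (in $\mathcal S$ and $\mathcal U$) are finite or infinite sequences of states linked by edges; only paths that are infinite or end in an expression are considered. Decomposition: each transition $P|Q\xrightarrow{\ell}R$ derives via the rules from either a transition $P\xrightarrow{}P'$ and the state $Q$ ($R=P'|Q$), or transitions $P\to P'$ and $Q\to Q'$ ($R=P'|Q'$), or the state $P$ and a transition $Q\to Q'$ ($R=P|Q'$); a decomposition of a path $\pi$ of $P|Q$ into paths $\pi_1$ of $P$ and $\pi_2$ of $Q$ (notation $\pi\in\pi_1|\pi_2$) chooses such a decomposition for each transition and concatenates the left components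 into $\pi_1$ and right components into $\pi_2$ ($\pi$ may be infinite with one of $\pi_1,\pi_2$ finite). Each transition $P[f]\xrightarrow{\ell}R$ (resp. of $P\backslash c$) stems from a transition $P\to P'$ with $R=P'[f]$ (resp. $P'\backslash c$), giving decompositions of paths of $P[f]$, $P\backslash c$ into paths of $P$. $Y$-justness ($Y\subseteq H$) is the largest family of predicates on paths in $\mathcal S$ such that: a finite $Y$-just path ends in an expression all of whose outgoing transitions are labelled in $Y\cup\mathcal B?$; a $Y$-just path of $P|Q$ can be decomposed into an $X$-just path of $P$ and a $Z$-just path of $Q$ with $X\cup Z\subseteq Y$ and $X\cap\bar Z=\emptyset$; a $Y$-just path of $P\backslash c$ decomposes into a $(Y\cup\{c,\bar c\})$-just path of $P$; a $Y$-just path of $P[f]$ decomposes into an $f^{-1}(Y)$-just path of $P$; every suffix of a $Y$-just path is $Y$-just. A path is just if it is $Y$-just for some $Y\subseteq H$. Derivations: each derivation of a transition from the rules is named: $(\alpha\to P)$ for (Act) on $\alpha.P$; $\chi|\zeta$ for (Comm) or (Bro-c) from derivations $\chi,\zeta$ of the premises; $\chi|Q$ for (Par-l) or (Bro-l) from $\chi$ with $Q$ the right component; $P|\zeta$ for (Par-r)/(Bro-r); $\chi{+}Q$, $P{+}\chi$, $\chi[f]$, $\chi\backslash c$, $A{:}\chi$ for (Sum-l), (Sum-r), (Rel), (Res), (Rec). For a derivation $\chi$ of $P\xrightarrow{\alpha}Q$: $src(\chi)=P$, $target(\chi)=Q$, $\ell(\chi)=\alpha$. $\mathcal U$: states are expressions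 and derivations; edges $src(\chi)\to\chi\to target(\chi)$. $\widehat P=P$, $\widehat\chi=(src(\chi),\ell(\chi),target(\chi))$, extended elementwise to paths. Concurrency $\smile^\bullet$ is the smallest relation on derivations such that (whenever the composed derivations exist): $\chi|Q\smile^\bullet P|\zeta$ and $P|\zeta\smile^\bullet\chi|Q$ if $src(\chi)=P$, $src(\zeta)=Q$; $\chi|\varsigma\smile^\bullet P|\zeta$ and $\varsigma|\chi\smile^\bullet\zeta|P$ if $src(\chi)=P$, $src(\varsigma)=src(\zeta)$, $\ell(\varsigma)\in\mathcal B?$; $\chi\smile^\bullet\zeta$ implies $\chi{+}P\smile^\bullet\zeta{+}P$, $P{+}\chi\smile^\bullet P{+}\zeta$, $\chi|P\smile^\bullet\zeta|P$, $P|\chi\smile^\bullet P|\zeta$; $\chi\smile^\bullet\zeta$ implies $\chi|P\smile^\bullet\zeta|\xi$, $\chi|\xi\smile^\bullet\zeta|P$, $P|\chi\smile^\bullet\xi|\zeta$, $\xi|\chi\smile^\bullet P|\zeta$ if $P=src(\xi)$; $\chi\smile^\bullet\zeta$ implies $\chi|\varsigma\smile^\bullet\zeta|\xi$ and $\varsigma|\chi\smile^\bullet\xi|\zeta$ if $src(\varsigma)=src(\xi)$ and $\ell(\varsigma)\in\mathcal B?$; $\chi\smile^\bullet\zeta$ and $\varsigma\smile^\bullet\xi$ imply $\chi|\varsigma\smile^\bullet\zeta|\xi$; $\chi\smile^\bullet\zeta$ implies $\chi\backslash c\smile^\bullet\zeta\backslash c$, $\chi[f]\smile^\bullet\zeta[f]$,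 $A{:}\chi\smile^\bullet A{:}\zeta$. $\equiv$ is the smallest equivalence on derivations $\chi$ with $\ell(\chi)\notin\mathcal B?$ such that (whenever derivations exist): $\chi|P\equiv\chi|Q$, $P|\chi\equiv Q|\chi$; $\chi|\varsigma\equiv\chi|P$ and $\varsigma|\chi\equiv P|\chi$ if $\ell(\chi)\in\mathcal B!$; $\chi{+}P\equiv\chi\equiv P{+}\chi$, $A{:}\chi\equiv\chi$; $\chi\equiv\zeta$ implies $\chi\backslash c\equiv\zeta\backslash c$, $\chi[f]\equiv\zeta[f]$, $\chi|P\equiv\zeta|P$, $P|\chi\equiv P|\zeta$; $\chi\equiv\zeta$ and $\varsigma\equiv\xi$ imply $\chi|\varsigma\equiv\zeta|\xi$. Abstract transitions are the $\equiv$-classes; elements are representatives; $\ell([\chi]_\equiv)=\ell(\chi)$. Atomic propositions on states $u$ of $\mathcal U$: $u\models\nu$ iff $u$ is a derivation $\zeta$ with $[\zeta]_\equiv=\nu$; $P\models\mathit{en}(\nu)$ for an expression $P$ iff $P=src(\chi)$ for some representative $\chi$ of $\nu$; $\zeta\models\mathit{en}(\nu)$ for a derivation $\zeta$ iff $\chi\smile^\bullet\zeta$ for some representative $\chi$ of $\nu$. LTL on paths of $\mathcal U$: $\pi\models\mathbf{FG}\phi$ iff some suffix has $\phi$ in all its states (for finite $\pi$: $\phi$ holds in its last state); $\pi\models\mathbf{GF}\phi$ iff $\phi$ holds in infinitely many states (for finite $\pi$: in its last state). *)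

(* Defs.v *)
From Stdlib Require Import Classical.

Set Implicit Arguments.
Unset Strict Implicit.

(** * Actions and expressions of ABC *)

Section Syntax.

Variables A B C : Type.

Inductive hs : Type :=
| Name (c : C)
| CoName (c : C).

Definition bar (h : hs) : hs :=
  match h with Name c => CoName c | CoName c => Name c end.

Inductive sharp : Type := Snd | Rcv.

(* [Bro b Snd] is b!, [Bro b Rcv] is b?. *)
Inductive act : Type :=
| Bro (b : B) (s : sharp)
| Hs (h : hs)
| Tau.

Definition sharp_comp (s1 s2 : sharp) : option sharp :=
  match s1, s2 with
  | Snd, Rcv | Rcv, Snd => Some Snd
  | Rcv, Rcv => Some Rcv
  | Snd, Snd => None
  end.

Definition is_hs_or_tau (a : act) : Prop :=
  match a with Bro _ _ => False | Hs _ | Tau => True end.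

Definition is_send (a : act) : Prop := exists b, a = Bro b Snd.
Definition is_receive (a : act) : Prop := exists b, a = Bro b Rcv.
Definition non_blocking (a : act) : Prop := is_send a \/ a = Tau.

Record relabelling : Type := Relabelling { relB : B -> B; relC : C -> C }.

Definition rel_hs (f : relabelling) (h : hs) : hs :=
  match h with Name c => Name (relC f c) | CoName c => CoName (relC f c) end.

Definition rel_act (f : relabelling) (a : act) : act :=
  match a with
  | Bro b s => Bro (relB f b) s
  | Hs h => Hs (rel_hs f h)
  | Tau => Tau
  end.

Inductive expr : Type :=
| Nil
| Pre (a : act) (E : expr)
| Sum (E F : expr)
| Par (E F : expr)
| Res (E : expr) (c : hs)
| Rel (E : expr) (f : relabelling)
| Agent (X : A).

(* Every agent identifier occurs within the scope of a prefix. *)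
Fixpoint guarded (E : expr) : Prop :=
  match E with
  | Nil | Pre _ _ => True
  | Sum E F | Par E F => guarded E /\ guarded F
  | Res E _ | Rel E _ => guarded E
  | Agent _ => False
  end.

(** * Names of derivations *)

Inductive deriv : Type :=
| DAct (a : act) (P : expr)
| DPar (x y : deriv)
| DParL (x : deriv) (Q : expr)
| DParR (P : expr) (y : deriv)
| DSumL (x : deriv) (Q : expr)
| DSumR (P : expr) (x : deriv)
| DRel (x : deriv) (f : relabelling)
| DRes (x : deriv) (c : hs)
| DRec (X : A) (x : deriv).

Fixpoint src (x : deriv) : expr :=
  match x with
  | DAct a P => Pre a P
  | DPar x y => Par (src x) (src y)
  | DParL x Q => Par (src x) Q
  | DParR P y => Par P (src y)
  | DSumL x Q => Sum (src x) Q
  | DSumR P x => Sum P (src x)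
  | DRel x f => Rel (src x) f
  | DRes x c => Res (src x) c
  | DRec X _ => Agent X
  end.

Fixpoint target (x : deriv) : expr :=
  match x with
  | DAct _ P => P
  | DPar x y => Par (target x) (target y)
  | DParL x Q => Par (target x) Q
  | DParR P y => Par P (target y)
  | DSumL x _ | DSumR _ x | DRec _ x => target x
  | DRel x f => Rel (target x) f
  | DRes x c => Res (target x) c
  end.

(* On a [DPar] that is not a derivation the value is irrelevant. *)
Fixpoint label (x : deriv) : act :=
  match x with
  | DAct a _ => a
  | DPar x y =>
      match label x, label y with
      | Bro b s1, Bro _ s2 =>
          match sharp_comp s1 s2 with Some s => Bro b s | None => Tau end
      | _, _ => Tau
      end
  | DParL x _ | DParR _ x | DSumL x _ | DSumR _ x | DRes x _ | DRec _ x => label x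
  | DRel x f => rel_act f (label x)
  end.

(** * Structural operational semantics *)

(* [defn X] is the right-hand side of the defining equation of [X]. *)
Variable defn : A -> expr.

(* [derives_wrt rcv x P a Q]: [x] names a derivation of P --a--> Q, where the
   negative premise "F has no b?-transition" is read as [~ rcv F b]. *)
Inductive derives_wrt (rcv : expr -> B -> Prop) : deriv -> expr -> act -> expr -> Prop :=
| R_Act a E :
    derives_wrt rcv (DAct a E) (Pre a E) a E
| R_SumL x E F a E' :
    derives_wrt rcv x E a E' ->
    derives_wrt rcv (DSumL x F) (Sum E F) a E'
| R_SumR x E F a F' :
    derives_wrt rcv x F a F' ->
    derives_wrt rcv (DSumR E x) (Sum E F) a F'
| R_ParL x E F a E' :
    derives_wrt rcv x E a E' -> is_hs_or_tau a ->
    derives_wrt rcv (DParL x F) (Par E F) a (Par E' F)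
| R_ParR x E F a F' :
    derives_wrt rcv x F a F' -> is_hs_or_tau a ->
    derives_wrt rcv (DParR E x) (Par E F) a (Par E F')
| R_Comm x y E F c E' F' :
    derives_wrt rcv x E (Hs c) E' -> derives_wrt rcv y F (Hs (bar c)) F' ->
    derives_wrt rcv (DPar x y) (Par E F) Tau (Par E' F')
| R_BroL x E F b s E' :
    derives_wrt rcv x E (Bro b s) E' -> ~ rcv F b ->
    derives_wrt rcv (DParL x F) (Par E F) (Bro b s) (Par E' F)
| R_BroR x E F b s F' :
    derives_wrt rcv x F (Bro b s) F' -> ~ rcv E b ->
    derives_wrt rcv (DParR E x) (Par E F) (Bro b s) (Par E F')
| R_BroC x y E F b s1 s2 s E' F' :
    derives_wrt rcv x E (Bro b s1) E' -> derives_wrt rcv y F (Bro b s2) F' ->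
    sharp_comp s1 s2 = Some s ->
    derives_wrt rcv (DPar x y) (Par E F) (Bro b s) (Par E' F')
| R_Rel x E f a E' :
    derives_wrt rcv x E a E' ->
    derives_wrt rcv (DRel x f) (Rel E f) (rel_act f a) (Rel E' f)
| R_Res x E c a E' :
    derives_wrt rcv x E a E' -> a <> Hs c -> a <> Hs (bar c) ->
    derives_wrt rcv (DRes x c) (Res E c) a (Res E' c)
| R_Rec x X a E' :
    derives_wrt rcv x (defn X) a E' ->
    derives_wrt rcv (DRec X x) (Agent X) a E'.

(* The negative premises make the rules self-referential: the intended [rcv] is
   one for which [rcv F b] holds exactly when [F] has a b?-transition. *)
Definition coherent (rcv : expr -> B -> Prop) : Prop :=
  forall F b, rcv F b <-> exists x F', derives_wrt rcv x F (Bro b Rcv) F'.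

(* The b?-transitions of E|F exist as soon as E or F has one, so [rcv] can be
   given by a positive definition. For guarded defining equations it is
   coherent, and is the only coherent choice: [can_receive_coherent] and
   [coherent_unique] below. *)
Inductive can_receive : expr -> B -> Prop :=
| cr_Pre b E : can_receive (Pre (Bro b Rcv) E) b
| cr_SumL E F b : can_receive E b -> can_receive (Sum E F) b
| cr_SumR E F b : can_receive F b -> can_receive (Sum E F) b
| cr_ParL E F b : can_receive E b -> can_receive (Par E F) b
| cr_ParR E F b : can_receive F b -> can_receive (Par E F) b
| cr_Rel E f b : can_receive E b -> can_receive (Rel E f) (relB f b)
| cr_Res E c b : can_receive E b -> can_receive (Res E c) b
| cr_Rec X b : can_receive (defn X) b -> can_receive (Agent X) b.

Definition derives : deriv -> expr -> act -> expr -> Prop := derives_wrt can_receive.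

Definition is_derivation (x : deriv) : Prop := exists P a Q, derives x P a Q.

Definition transition (P : expr) (a : act) (Q : expr) : Prop :=
  exists x, derives x P a Q.

Lemma derives_src_label_target x P a Q :
  derives x P a Q -> src x = P /\ label x = a /\ target x = Q.
Proof.
unfold derives; intros H; induction H; simpl;
  repeat match goal with H : _ /\ _ |- _ => destruct H end;
  repeat match goal with
    | H : label _ = _ |- _ => rewrite H
    | H : src _ = _ |- _ => rewrite H
    | H : target _ = _ |- _ => rewrite H
  end; auto.
now rewrite H1.
Qed.

Lemma derives_wrt_can_receive rcv x F a F' :
  derives_wrt rcv x F a F' -> forall b, a = Bro b Rcv -> can_receive F b.
Proof.
intros H; induction H; intros b0 e; subst; try discriminate; simpl in *;
  try contradiction; try (constructor; now auto).
- injection e as -> ->; destruct s1, s2; try discriminate; apply cr_ParL; auto.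
- destruct a; try discriminate; injection e as <- ->; apply cr_Rel; auto.
Qed.

Lemma can_receive_derives_wrt rcv :
  (forall F b, rcv F b -> can_receive F b) ->
  forall E,
  guarded E \/ (forall X b, can_receive (defn X) b ->
                  exists x F', derives_wrt rcv x (defn X) (Bro b Rcv) F') ->
  forall b, can_receive E b -> exists x F', derives_wrt rcv x E (Bro b Rcv) F'.
Proof.
intros Hr E.
induction E as [|a E IH|E IHE F IHF|E IHE F IHF|E IH c|E IH f|X]; simpl;
  intros g b H.
- inversion H.
- inversion H; subst; eauto using derives_wrt.
- inversion H as [|? ? ? K|? ? ? K| | | | |]; subst.
  + destruct (IHE ltac:(tauto) _ K) as (x & F' & D); eauto using derives_wrt.
  + destruct (IHF ltac:(tauto) _ K) as (x & F' & D); eauto using derives_wrt.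
- inversion H as [| | |? ? ? K|? ? ? K| | |]; subst.
  + destruct (IHE ltac:(tauto) _ K) as (x & E' & D).
    destruct (classic (rcv F b)) as [N|N].
    * destruct (IHF ltac:(tauto) _ (Hr _ _ N)) as (y & F' & D').
      exists (DPar x y), (Par E' F'); eapply R_BroC; eauto.
    * exists (DParL x F), (Par E' F); now apply R_BroL.
  + destruct (IHF ltac:(tauto) _ K) as (y & F' & D).
    destruct (classic (rcv E b)) as [N|N].
    * destruct (IHE ltac:(tauto) _ (Hr _ _ N)) as (x & E' & D').
      exists (DPar x y), (Par E' F'); eapply R_BroC; eauto.
    * exists (DParR E y), (Par E F'); now apply R_BroR.
- inversion H as [| | | | | |? ? ? K|]; subst.
  destruct (IH g _ K) as (x & E' & D).
  exists (DRes x c), (Res E' c); apply R_Res; auto; discriminate.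
- inversion H as [| | | | |? ? b' K| |]; subst.
  destruct (IH g _ K) as (x & E' & D).
  exists (DRel x f), (Rel E' f); exact (R_Rel f D).
- destruct g as [[]|g].
  inversion H as [| | | | | | |? ? K]; subst.
  destruct (g _ _ K) as (x & F' & D).
  exists (DRec X x), F'; now apply R_Rec.
Qed.

Lemma can_receive_coherent :
  (forall X, guarded (defn X)) -> coherent can_receive.
Proof.
intros Hg F b; split.
- apply can_receive_derives_wrt; auto.
  right; intros X b'; apply can_receive_derives_wrt; auto.
- intros (x & F' & D); exact (derives_wrt_can_receive D eq_refl).
Qed.

Lemma coherent_unique rcv :
  (forall X, guarded (defn X)) -> coherent rcv ->
  forall F b, rcv F b <-> can_receive F b.
Proof.
intros Hg Hc.
assert (Hr : forall F b, rcv F b -> can_receive F b).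
{ intros F b H; apply Hc in H; destruct H as (x & F' & D).
  exact (derives_wrt_can_receive D eq_refl). }
intros F b; split; auto.
intros H; apply Hc; revert H; apply can_receive_derives_wrt; auto.
right; intros X b'; apply can_receive_derives_wrt; auto.
Qed.

(** * Concurrency and equivalence of derivations *)

(* "Whenever the composed derivations exist" is rendered by requiring both
   sides of each conclusion to be derivations. *)
Inductive conc : deriv -> deriv -> Prop :=
| conc_lr x y P Q :
    src x = P -> src y = Q ->
    is_derivation (DParL x Q) -> is_derivation (DParR P y) ->
    conc (DParL x Q) (DParR P y)
| conc_rl x y P Q :
    src x = P -> src y = Q ->
    is_derivation (DParR P y) -> is_derivation (DParL x Q) ->
    conc (DParR P y) (DParL x Q)
| conc_recv_r x s y P :
    src x = P -> src s = src y -> is_receive (label s) ->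
    is_derivation (DPar x s) -> is_derivation (DParR P y) ->
    conc (DPar x s) (DParR P y)
| conc_recv_l x s y P :
    src x = P -> src s = src y -> is_receive (label s) ->
    is_derivation (DPar s x) -> is_derivation (DParL y P) ->
    conc (DPar s x) (DParL y P)
| conc_SumL x y P :
    conc x y -> is_derivation (DSumL x P) -> is_derivation (DSumL y P) ->
    conc (DSumL x P) (DSumL y P)
| conc_SumR x y P :
    conc x y -> is_derivation (DSumR P x) -> is_derivation (DSumR P y) ->
    conc (DSumR P x) (DSumR P y)
| conc_ParL x y P :
    conc x y -> is_derivation (DParL x P) -> is_derivation (DParL y P) ->
    conc (DParL x P) (DParL y P)
| conc_ParR x y P :
    conc x y -> is_derivation (DParR P x) -> is_derivation (DParR P y) ->
    conc (DParR P x) (DParR P y)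
| conc_ParL_Par x y z P :
    conc x y -> P = src z ->
    is_derivation (DParL x P) -> is_derivation (DPar y z) ->
    conc (DParL x P) (DPar y z)
| conc_Par_ParL x y z P :
    conc x y -> P = src z ->
    is_derivation (DPar x z) -> is_derivation (DParL y P) ->
    conc (DPar x z) (DParL y P)
| conc_ParR_Par x y z P :
    conc x y -> P = src z ->
    is_derivation (DParR P x) -> is_derivation (DPar z y) ->
    conc (DParR P x) (DPar z y)
| conc_Par_ParR x y z P :
    conc x y -> P = src z ->
    is_derivation (DPar z x) -> is_derivation (DParR P y) ->
    conc (DPar z x) (DParR P y)
| conc_Par_recv_r x y s z :
    conc x y -> src s = src z -> is_receive (label s) ->
    is_derivation (DPar x s) -> is_derivation (DPar y z) ->
    conc (DPar x s) (DPar y z)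
| conc_Par_recv_l x y s z :
    conc x y -> src s = src z -> is_receive (label s) ->
    is_derivation (DPar s x) -> is_derivation (DPar z y) ->
    conc (DPar s x) (DPar z y)
| conc_Par x y s z :
    conc x y -> conc s z ->
    is_derivation (DPar x s) -> is_derivation (DPar y z) ->
    conc (DPar x s) (DPar y z)
| conc_Res x y c :
    conc x y -> is_derivation (DRes x c) -> is_derivation (DRes y c) ->
    conc (DRes x c) (DRes y c)
| conc_Rel x y f :
    conc x y -> is_derivation (DRel x f) -> is_derivation (DRel y f) ->
    conc (DRel x f) (DRel y f)
| conc_Rec x y X :
    conc x y -> is_derivation (DRec X x) -> is_derivation (DRec X y) ->
    conc (DRec X x) (DRec X y).

Definition eqd_dom (x : deriv) : Prop := is_derivation x /\ ~ is_receive (label x).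

Inductive eqd : deriv -> deriv -> Prop :=
| eqd_refl x : eqd_dom x -> eqd x x
| eqd_sym x y : eqd x y -> eqd y x
| eqd_trans x y z : eqd x y -> eqd y z -> eqd x z
| eqd_ParL_ctx x P Q :
    eqd_dom (DParL x P) -> eqd_dom (DParL x Q) -> eqd (DParL x P) (DParL x Q)
| eqd_ParR_ctx x P Q :
    eqd_dom (DParR P x) -> eqd_dom (DParR Q x) -> eqd (DParR P x) (DParR Q x)
| eqd_sendL x s P :
    is_send (label x) ->
    eqd_dom (DPar x s) -> eqd_dom (DParL x P) -> eqd (DPar x s) (DParL x P)
| eqd_sendR x s P :
    is_send (label x) ->
    eqd_dom (DPar s x) -> eqd_dom (DParR P x) -> eqd (DPar s x) (DParR P x)
| eqd_SumL x P : eqd_dom (DSumL x P) -> eqd_dom x -> eqd (DSumL x P) x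
| eqd_SumR x P : eqd_dom (DSumR P x) -> eqd_dom x -> eqd x (DSumR P x)
| eqd_Rec x X : eqd_dom (DRec X x) -> eqd_dom x -> eqd (DRec X x) x
| eqd_Res x y c :
    eqd x y -> eqd_dom (DRes x c) -> eqd_dom (DRes y c) -> eqd (DRes x c) (DRes y c)
| eqd_Rel x y f :
    eqd x y -> eqd_dom (DRel x f) -> eqd_dom (DRel y f) -> eqd (DRel x f) (DRel y f)
| eqd_ParL x y P :
    eqd x y -> eqd_dom (DParL x P) -> eqd_dom (DParL y P) -> eqd (DParL x P) (DParL y P)
| eqd_ParR x y P :
    eqd x y -> eqd_dom (DParR P x) -> eqd_dom (DParR P y) -> eqd (DParR P x) (DParR P y)
| eqd_Par x y s z :
    eqd x y -> eqd s z -> eqd_dom (DPar x s) -> eqd_dom (DPar y z) ->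
    eqd (DPar x s) (DPar y z).

(* Abstract transitions are the equivalence classes, as sets of derivations;
   [nu x] says that [x] is a representative of [nu], i.e. [x] has class [nu]. *)
Definition abstract_transition (nu : deriv -> Prop) : Prop :=
  exists x, eqd_dom x /\ forall y, nu y <-> eqd x y.

Definition abs_label (nu : deriv -> Prop) (a : act) : Prop :=
  exists x, nu x /\ label x = a.

(** * Paths *)

Section Paths.

Variable S : Type.

(* A finite sequence of length n is [Some] below n and [None] from n on. *)
Definition sequence : Type := nat -> option S.

Definition suffix (n : nat) (p : sequence) : sequence := fun m => p (n + m).

Definition occurs (p : sequence) (n : nat) : Prop := p n <> None.

(* A path may start in any state, but if finite it ends in one satisfying
   [final]. *)
Definition is_path (edge : S -> S -> Prop) (final : S -> Prop) (p : sequence) : Prop :=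
  occurs p 0 /\
  (forall n, occurs p (1 + n) -> occurs p n) /\
  (forall n s t, p n = Some s -> p (1 + n) = Some t -> edge s t) /\
  (forall n s, p n = Some s -> p (1 + n) = None -> final s).

(* Linear-time temporal logic, with formulas as predicates on paths. On a
   finite path both FG phi and GF phi say that phi holds in the last state. *)
Definition ltl_atom (phi : S -> Prop) (p : sequence) : Prop :=
  exists s, p 0 = Some s /\ phi s.
Definition ltl_F (phi : sequence -> Prop) (p : sequence) : Prop :=
  exists n, occurs p n /\ phi (suffix n p).
Definition ltl_G (phi : sequence -> Prop) (p : sequence) : Prop :=
  forall n, occurs p n -> phi (suffix n p).
Definition ltl_imp (phi psi : sequence -> Prop) (p : sequence) : Prop :=
  phi p -> psi p.

End Paths.

(* The Kripke structure S. *)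
Inductive sstate : Type :=
| SExpr (P : expr)
| STrans (P : expr) (a : act) (Q : expr).

Inductive sedge : sstate -> sstate -> Prop :=
| sedge_out P a Q : transition P a Q -> sedge (SExpr P) (STrans P a Q)
| sedge_in P a Q : transition P a Q -> sedge (STrans P a Q) (SExpr Q).

Definition sfinal (s : sstate) : Prop := exists P, s = SExpr P.

Definition is_spath : sequence sstate -> Prop := is_path sedge sfinal.

(* The Kripke structure U. *)
Inductive ustate : Type :=
| UExpr (P : expr)
| UDeriv (x : deriv).

Inductive uedge : ustate -> ustate -> Prop :=
| uedge_out x : is_derivation x -> uedge (UExpr (src x)) (UDeriv x)
| uedge_in x : is_derivation x -> uedge (UDeriv x) (UExpr (target x)).

Definition ufinal (u : ustate) : Prop := exists P, u = UExpr P.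

Definition is_upath : sequence ustate -> Prop := is_path uedge ufinal.

Definition hat_deriv (x : deriv) : sstate := STrans (src x) (label x) (target x).

Definition hat (u : ustate) : sstate :=
  match u with UExpr P => SExpr P | UDeriv x => hat_deriv x end.

Definition hat_path (p : sequence ustate) : sequence sstate :=
  fun n => option_map hat (p n).

Definition holds_abs (nu : deriv -> Prop) (u : ustate) : Prop :=
  match u with UExpr _ => False | UDeriv z => nu z end.

Definition enabled (nu : deriv -> Prop) (u : ustate) : Prop :=
  match u with
  | UExpr P => exists x, nu x /\ P = src x
  | UDeriv z => exists x, nu x /\ conc x z
  end.

(** * Decomposition of paths *)

(* A transition of P|Q together with a way to derive it from a transition
   and/or a state of P and of Q. *)
Inductive dec_par_state : sstate -> sstate -> sstate -> Prop :=
| dps_expr P Q :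
    dec_par_state (SExpr (Par P Q)) (SExpr P) (SExpr Q)
| dps_left x Q : is_derivation (DParL x Q) ->
    dec_par_state (hat_deriv (DParL x Q)) (hat_deriv x) (SExpr Q)
| dps_both x y : is_derivation (DPar x y) ->
    dec_par_state (hat_deriv (DPar x y)) (hat_deriv x) (hat_deriv y)
| dps_right P y : is_derivation (DParR P y) ->
    dec_par_state (hat_deriv (DParR P y)) (SExpr P) (hat_deriv y).

(* [l] sends each position of a path to a position of its component, standing
   still while the component does not move, and reaching all of it. *)
Definition tracks (p p1 : sequence sstate) (l : nat -> nat) : Prop :=
  l 0 = 0 /\
  (forall n, l (1 + n) = l n \/ l (1 + n) = 1 + l n) /\
  (forall m, occurs p1 m -> exists n, occurs p n /\ l n = m).

(* The components are paths, so transitions and expressions alternate in them;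
   hence [l] advances twice over each transition in which the left component
   takes part and not at all over the others, and likewise for [r]. *)
Definition decomp_par (p p1 p2 : sequence sstate) : Prop :=
  is_spath p1 /\ is_spath p2 /\
  exists l r : nat -> nat,
    tracks p p1 l /\ tracks p p2 r /\
    forall n s, p n = Some s ->
      exists s1 s2, p1 (l n) = Some s1 /\ p2 (r n) = Some s2 /\ dec_par_state s s1 s2.

Inductive dec_res_state (c : hs) : sstate -> sstate -> Prop :=
| drs_expr P : dec_res_state c (SExpr (Res P c)) (SExpr P)
| drs_trans x : is_derivation (DRes x c) ->
    dec_res_state c (hat_deriv (DRes x c)) (hat_deriv x).

Inductive dec_rel_state (f : relabelling) : sstate -> sstate -> Prop :=
| dls_expr P : dec_rel_state f (SExpr (Rel P f)) (SExpr P)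
| dls_trans x : is_derivation (DRel x f) ->
    dec_rel_state f (hat_deriv (DRel x f)) (hat_deriv x).

Definition decomp_unary (dec : sstate -> sstate -> Prop) (p p1 : sequence sstate) : Prop :=
  is_spath p1 /\
  forall n, match p n, p1 n with
            | Some s, Some s1 => dec s s1
            | None, None => True
            | _, _ => False
            end.

(** * Justness *)

Definition hset : Type := hs -> Prop.

Definition in_Y_or_receive (Y : hset) (a : act) : Prop :=
  (exists h, a = Hs h /\ Y h) \/ is_receive a.

(* "A path of P" is a path whose first state is the expression P. *)
Record just_family (J : hset -> sequence sstate -> Prop) : Prop := JustFamily {
  jf_path : forall Y p, J Y p -> is_spath p;
  jf_finite : forall Y p, J Y p ->
    forall n P, p n = Some (SExpr P) -> p (1 + n) = None ->
    forall a Q, transition P a Q -> in_Y_or_receive Y a;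
  jf_par : forall Y p, J Y p ->
    forall P Q, p 0 = Some (SExpr (Par P Q)) ->
    exists (p1 p2 : sequence sstate) (X Z : hset),
      decomp_par p p1 p2 /\ J X p1 /\ J Z p2 /\
      (forall h, X h \/ Z h -> Y h) /\
      (forall h, ~ (X h /\ Z (bar h)));
  jf_res : forall Y p, J Y p ->
    forall P c, p 0 = Some (SExpr (Res P c)) ->
    exists p1, decomp_unary (dec_res_state c) p p1 /\
      J (fun h => Y h \/ h = c \/ h = bar c) p1;
  jf_rel : forall Y p, J Y p ->
    forall P f, p 0 = Some (SExpr (Rel P f)) ->
    exists p1, decomp_unary (dec_rel_state f) p p1 /\
      J (fun h => Y (rel_hs f h)) p1;
  jf_suffix : forall Y p, J Y p ->
    forall n, occurs p n -> J Y (suffix n p)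
}.

Definition Y_just (Y : hset) (p : sequence sstate) : Prop :=
  exists J, just_family J /\ J Y p.

Definition just (p : sequence sstate) : Prop := exists Y, Y_just Y p.

Lemma Y_just_largest :
  just_family Y_just /\
  forall J, just_family J -> forall Y p, J Y p -> Y_just Y p.
Proof.
split; [split|]; intros.
- destruct H as (J & HJ & H); exact (jf_path HJ H).
- destruct H as (J & HJ & H); exact (jf_finite HJ H H0 H1 H2).
- destruct H as (J & HJ & H).
  destruct (jf_par HJ H H0) as (p1 & p2 & X & Z & D & J1 & J2 & K).
  exists p1, p2, X, Z; split; [exact D|split; [|split; [|exact K]]]; now exists J.
- destruct H as (J & HJ & H).
  destruct (jf_res HJ H H0) as (p1 & D & K).
  exists p1; split; [exact D|]; now exists J.
- destruct H as (J & HJ & H).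
  destruct (jf_rel HJ H H0) as (p1 & D & K).
  exists p1; split; [exact D|]; now exists J.
- destruct H as (J & HJ & H); exists J; split; [exact HJ|].
  exact (jf_suffix HJ H H0).
- now exists J.
Qed.

End Syntax.

Arguments Tau {B C}.
Arguments Nil {A B C}.

(* Main.v *)
From Stdlib Require Import Classical ClassicalEpsilon FunctionalExtensionality Lia.
Require Import Defs.

Set Implicit Arguments.
Unset Strict Implicit.

(** Every abstract transition has a canonical representative, obtained by
    deleting sums, recursion unfoldings, idle components and broadcast receivers,
    and two derivations are equivalent iff their canonical representatives
    coincide. A derivation is never concurrent with an equivalent one, so
    FG en(nu) excludes GF nu, and the temporal formula just says that nu is not
    persistently enabled. Call a path of U Y-fair if all persistently enabled
    abstract transitions are labelled in Y.

    The paths that lift to Y-fair paths form a justness family: for a path of P|Q,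
    take as X and Z the handshakes that stay enabled in the left and right
    components; a handshake in X whose complement is in Z would give a
    persistently enabled tau.

    Conversely, fix a decomposition for each Y-just path. Following these down to
    prefixes, sums and agent identifiers selects a derivation for each transition,
    and induction on the canonical representative shows that the resulting path is
    Y-fair: once an enabled transition has survived one step, the path is in the
    scope of a parallel composition, restriction or relabelling, and the
    transition can be pushed into the components. *)

(** * Sequences *)

(** The clauses of [tracks] that concern the position map alone. *)
Definition slow (l : nat -> nat) : Prop :=
  l 0 = 0 /\ forall n, l (1 + n) = l n \/ l (1 + n) = 1 + l n.

Lemma slow_mono (l : nat -> nat) : slow l -> forall n m, n <= m -> l n <= l m.
Proof.
intros [_ Hl] n m H; induction H as [|m H IH]; auto.
destruct (Hl m) as [E|E]; simpl in E; lia.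
Qed.

Lemma slow_le (l : nat -> nat) : slow l -> forall n, l n <= n.
Proof.
intros [H0 Hl] n; induction n as [|n IH]; [lia|].
destruct (Hl n) as [E|E]; simpl in E; lia.
Qed.

Lemma occurs_le (S : Type) (p : sequence S) :
  (forall n, occurs p (1 + n) -> occurs p n) ->
  forall n m, n <= m -> occurs p m -> occurs p n.
Proof. intros H n m L; induction L; auto. Qed.

Lemma occurs_Some (S : Type) (p : sequence S) n :
  occurs p n <-> exists s, p n = Some s.
Proof.
unfold occurs; destruct (p n) as [s|]; split; try congruence; eauto.
intros [s H]; discriminate.
Qed.

Lemma suffix_path (S : Type) (edge : S -> S -> Prop) (final : S -> Prop) (p : sequence S) k :
  is_path edge final p -> occurs p k -> is_path edge final (suffix k p).
Proof.
unfold is_path, occurs, suffix; intros (H0 & H1 & H2 & H3) Hk; repeat split; [|intros n..].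
- now rewrite <- plus_n_O.
- rewrite <- !plus_n_Sm; apply H1.
- rewrite <- !plus_n_Sm; apply H2.
- rewrite <- !plus_n_Sm; apply H3.
Qed.

(** * Destuttering the image of a path *)

Section Destutter.

Variables (S T : Type) (edge : T -> T -> Prop) (final : T -> Prop).
Variables (p : sequence S) (c : S -> T).

Hypothesis p_start : occurs p 0.
Hypothesis p_closed : forall n, occurs p (1 + n) -> occurs p n.
Hypothesis c_edge : forall n s t, p n = Some s -> p (1 + n) = Some t ->
  c s = c t \/ edge (c s) (c t).
(** Standing still is allowed at final images only. If [p] is infinite but its image moves only
    finitely often, this makes the last state of the destuttered sequence final. *)
Hypothesis c_move : forall n s t, p n = Some s -> p (1 + n) = Some t ->
  final (c s) \/ c s <> c t.
Hypothesis c_end : forall n s, p n = Some s -> p (1 + n) = None -> final (c s).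

(** The future position map: it counts changes of image, equality in [T] being decided
    classically. *)
Fixpoint moves (n : nat) : nat :=
  match n with
  | 0 => 0
  | Datatypes.S k =>
      match p k, p n with
      | Some s, Some t =>
          if excluded_middle_informative (c s = c t) then moves k else 1 + moves k
      | _, _ => moves k
      end
  end.

Lemma moves_slow : slow moves.
Proof.
split; [reflexivity|]; intros n; simpl.
destruct (p n), (p (Datatypes.S n)); auto.
destruct excluded_middle_informative; auto.
Qed.

Lemma moves_stutter n m s t : n <= m -> p n = Some s -> p m = Some t ->
  moves n = moves m -> c s = c t.
Proof.
intros L; revert t; induction L as [|m L IH]; intros t Hs Ht E; [congruence|].
destruct (proj1 (occurs_Some p m)) as [u Hu].
{ apply p_closed; simpl; unfold occurs; congruence. }
assert (M := slow_mono moves_slow L); simpl in E; rewrite Hu, Ht in E.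
destruct excluded_middle_informative as [e|e]; [|lia].
rewrite <- e; now apply IH.
Qed.

(** A discrete intermediate value argument: each positive count is reached through a step that
    changes the image, and that step provides the edge between consecutive states of the destuttered
    sequence. *)
Lemma moves_jump m n : occurs p n -> moves n = 1 + m ->
  exists k s t, p k = Some s /\ p (1 + k) = Some t /\
    moves k = m /\ moves (1 + k) = 1 + m /\ c s <> c t.
Proof.
induction n as [|n IH]; intros O E; [discriminate|].
assert (O' := p_closed O); apply occurs_Some in O; destruct O as [t Ht].
assert (O2 := O'); apply occurs_Some in O2; destruct O2 as [s Hs].
assert (E' := E); simpl in E'; rewrite Hs, Ht in E'.
destruct excluded_middle_informative as [e|e]; [now apply IH|].
injection E' as E'; exists n, s, t; auto.
Qed.

Lemma destutter :
  exists (q : sequence T) (l : nat -> nat),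
    is_path edge final q /\ slow l /\
    (forall m, occurs q m -> exists n, occurs p n /\ l n = m) /\
    (forall n s, p n = Some s -> q (l n) = Some (c s)).
Proof.
(* All positions with count [m] have the same image by [moves_stutter], so this determines entry
   [m]; [None] is for counts never reached. *)
set (spec m o := (exists n s, p n = Some s /\ moves n = m /\ o = Some (c s)) \/
  ((forall n, occurs p n -> moves n <> m) /\ o = None)).
assert (ex : forall m, exists o, spec m o).
{ intros m; destruct (classic (exists n, occurs p n /\ moves n = m)) as [(n & O & E)|K].
  - apply occurs_Some in O; destruct O as [s Hs]; exists (Some (c s)); left; eauto.
  - exists None; right; split; auto; intros n O E; apply K; eauto. }
set (q m := epsilon (inhabits None) (spec m)).
assert (Hq : forall m, spec m (q m)) by (intros m; apply epsilon_spec, ex).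
assert (hit : forall n s, p n = Some s -> q (moves n) = Some (c s)).
{ intros n s Hs; destruct (Hq (moves n)) as [(k & t & Ht & E & ->)|[K _]].
  - f_equal; destruct (PeanoNat.Nat.le_ge_cases n k).
    + symmetry; eapply moves_stutter; eauto.
    + eapply moves_stutter; eauto.
  - exfalso; apply (K n); [unfold occurs; congruence|reflexivity]. }
assert (surj : forall m, occurs q m -> exists n, occurs p n /\ moves n = m).
{ intros m O; destruct (Hq m) as [(k & t & Ht & E & _)|[_ K]]; [|now destruct O].
  exists k; split; auto; unfold occurs; congruence. }
exists q, moves; split; [|auto using moves_slow].
assert (jump : forall m, occurs q (1 + m) -> exists k s t,
  p k = Some s /\ p (1 + k) = Some t /\ q m = Some (c s) /\ q (1 + m) = Some (c t) /\ c s <> c t).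
{ intros m O; destruct (surj _ O) as (n & On & E).
  destruct (moves_jump On E) as (k & s & t & Hs & Ht & E1 & E2 & N).
  exists k, s, t; rewrite <- E2, <- E1; repeat split; auto. }
repeat split.
- apply occurs_Some in p_start; destruct p_start as [s Hs].
  unfold occurs; change 0 with (moves 0); rewrite (hit _ _ Hs); discriminate.
- intros m O; destruct (jump m O) as (k & s & t & _ & _ & E & _).
  unfold occurs; congruence.
- intros m s' t' Hs' Ht'.
  destruct (jump m) as (k & s & t & Hs & Ht & E1 & E2 & N); [unfold occurs; congruence|].
  destruct (c_edge Hs Ht); congruence.
- intros m s' Hs' Ht'; destruct (surj m) as (n & On & E); [unfold occurs; congruence|].
  apply occurs_Some in On; destruct On as [s Hs].
  assert (s' = c s) as -> by (rewrite <- E, (hit _ _ Hs) in Hs'; congruence).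
  destruct (p (1 + n)) as [t|] eqn:Ht; [|now apply (c_end Hs)].
  destruct (c_move Hs Ht) as [F|N]; auto.
  (* A change of image after [n] would give the sequence an entry at [1 + m], beyond its supposed
     end. *)
  exfalso; assert (E' : moves (1 + n) = 1 + m).
  { simpl; simpl in Ht; rewrite Hs, Ht, E.
    now destruct excluded_middle_informative. }
  rewrite <- E', (hit _ _ Ht) in Ht'; discriminate.
Qed.

End Destutter.
Section Justness.

Variables A B C : Type.
Variable defn : A -> expr A B C.

Local Notation deriv := (deriv A B C).
Local Notation expr := (expr A B C).
Local Notation ustate := (ustate A B C).
Local Notation sstate := (sstate A B C).
Local Notation is_derivation := (is_derivation defn).
Local Notation eqd_dom := (eqd_dom defn).
Local Notation conc := (conc defn).

(** * Derivations and canonical representatives *)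

(** One side condition for (Par-l) and (Bro-l), and likewise for their mirror images: only a
    broadcast has to go unheard. *)
Definition unheard (a : act B C) (Q : expr) : Prop :=
  match a with Bro _ b _ => ~ can_receive defn Q b | _ => True end.

(** The joint side condition of (Comm) and (Bro-c). *)
Definition syncs (a1 a2 : act B C) : Prop :=
  match a1, a2 with
  | Hs _ h1, Hs _ h2 => h2 = bar h1
  | Bro _ b1 s1, Bro _ b2 s2 => b2 = b1 /\ sharp_comp s1 s2 <> None
  | _, _ => False
  end.

(** [is_derivation] without its quantifiers: source and label are computed, so that side conditions
    reduce by [simpl]. *)
Fixpoint valid (x : deriv) : Prop :=
  match x with
  | DAct _ _ => True
  | DPar x y => valid x /\ valid y /\ syncs (label x) (label y)
  | DParL x Q => valid x /\ unheard (label x) Q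
  | DParR P y => valid y /\ unheard (label y) P
  | DSumL x _ | DSumR _ x | DRel x _ => valid x
  | DRes x c => valid x /\ label x <> Hs B c /\ label x <> Hs B (bar c)
  | DRec X x => valid x /\ src x = defn X
  end.

Lemma valid_derives (x : deriv) :
  valid x -> derives defn x (src x) (label x) (target x).
Proof.
unfold derives; induction x as [a P|x IHx y IHy|x IH Q|P y IH|x IH Q|P x IH|x IH f|x IH c|X x IH];
  simpl; intros V.
- constructor.
- destruct V as (Vx & Vy & S); specialize (IHx Vx); specialize (IHy Vy).
  destruct (label x) as [b s|h|], (label y) as [b' s'|h'|]; simpl in S; try contradiction.
  + destruct S as [-> S]; destruct (sharp_comp s s') as [s0|] eqn:E; [|congruence].
    eapply R_BroC; eauto.
  + subst h'; eapply R_Comm; eauto.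
- destruct V as [V U]; specialize (IH V).
  destruct (label x); simpl in U; [apply R_BroL|apply R_ParL|apply R_ParL]; simpl; auto.
- destruct V as [V U]; specialize (IH V).
  destruct (label y); simpl in U; [apply R_BroR|apply R_ParR|apply R_ParR]; simpl; auto.
- now apply R_SumL, IH.
- now apply R_SumR, IH.
- now apply R_Rel, IH.
- now apply R_Res; [apply IH| |].
- destruct V as [V E]; apply R_Rec; rewrite <- E; auto.
Qed.

Lemma is_derivation_valid (x : deriv) : is_derivation x <-> valid x.
Proof.
split.
- intros (P & a & Q & D); unfold derives in D; induction D; simpl; auto;
    repeat match goal with
      | D : derives_wrt _ _ _ _ _ _ |- _ =>
          apply derives_src_label_target in D; destruct D as (? & D & ?)
    end;
    repeat match goal with D : label _ = _ |- _ => rewrite D end; simpl; auto.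
  + destruct a; simpl in *; tauto.
  + destruct a; simpl in *; tauto.
  + repeat split; auto; congruence.
- intros V; do 3 eexists; exact (valid_derives V).
Qed.

Lemma eqd_dom_valid (x : deriv) : eqd_dom x <-> valid x /\ ~ is_receive (label x).
Proof. unfold Defs.eqd_dom; rewrite is_derivation_valid; tauto. Qed.

Lemma is_receive_Bro (b : B) (s : sharp) : is_receive (Bro C b s) <-> s = Rcv.
Proof. split; [intros [b' E]; congruence|intros ->; now exists b]. Qed.

Lemma is_receive_rel_act (f : relabelling B C) (a : act B C) :
  is_receive (rel_act f a) <-> is_receive a.
Proof.
destruct a as [b s|h|]; simpl; [|split; intros [b E]; discriminate..].
now rewrite !is_receive_Bro.
Qed.

Lemma not_receive_Hs (h : hs C) : ~ is_receive (Hs B h).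
Proof. intros [b E]; discriminate. Qed.

Lemma not_receive_Tau : ~ is_receive (@Tau B C).
Proof. intros [b E]; discriminate. Qed.

(** [Nil] serves as the context of an isolated component because it hears no broadcast, so the side
    condition always holds. In a broadcast the label of [y] tells which side sends; if both sides
    receive, keeping the left one is an arbitrary choice. *)
Fixpoint canon (x : deriv) : deriv :=
  match x with
  | DAct a P => DAct a P
  | DPar x y =>
      match label y with
      | Bro _ _ Snd => DParR Nil (canon y)
      | Bro _ _ Rcv => DParL (canon x) Nil
      | _ => DPar (canon x) (canon y)
      end
  | DParL x _ => DParL (canon x) Nil
  | DParR _ y => DParR Nil (canon y)
  | DSumL x _ | DSumR _ x | DRec _ x => canon x
  | DRel x f => DRel (canon x) f
  | DRes x c => DRes (canon x) c
  end.

Lemma unheard_Nil (a : act B C) : unheard a Nil.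
Proof. destruct a; simpl; auto; intros H; inversion H. Qed.

(** Deleting a receiver keeps the label, because composing ! with ? gives ! and composing ? with ?
    gives ?. *)
Lemma canon_valid_label (x : deriv) :
  valid x -> valid (canon x) /\ label (canon x) = label x.
Proof.
induction x as [a P|x IHx y IHy|x IH Q|P y IH|x IH Q|P x IH|x IH f|x IH c|X x IH];
  simpl; intros V; auto.
- destruct V as (Vx & Vy & S); destruct (IHx Vx) as [Wx Lx], (IHy Vy) as [Wy Ly].
  destruct (label x) as [b s|h|], (label y) as [b' s'|h'|]; simpl in S; try contradiction.
  + destruct S as [-> S]; destruct s, s'; simpl in *; try congruence;
      rewrite ?Lx, ?Ly; repeat split; auto using unheard_Nil.
  + simpl; rewrite Lx, Ly; simpl; auto.
- destruct (IH (proj1 V)) as [W L]; simpl; auto using unheard_Nil.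
- destruct (IH (proj1 V)) as [W L]; simpl; auto using unheard_Nil.
- destruct (IH V) as [W ->]; auto.
- destruct (IH (proj1 V)) as [W L]; rewrite L; tauto.
- destruct (IH (proj1 V)) as [W L]; auto.
Qed.

Lemma label_canon (x : deriv) : valid x -> label (canon x) = label x.
Proof. apply canon_valid_label. Qed.

Lemma eqd_dom_canon (x : deriv) : eqd_dom x -> eqd_dom (canon x).
Proof.
rewrite !eqd_dom_valid; intros [V N].
destruct (canon_valid_label V) as [W ->]; auto.
Qed.

Lemma eqd_doms (x y : deriv) : eqd defn x y -> eqd_dom x /\ eqd_dom y.
Proof. intros H; induction H; tauto. Qed.

Lemma eqd_canon (x y : deriv) : eqd defn x y -> canon x = canon y.
Proof.
intros H; induction H; simpl; try congruence.
(* The partner of a sender must be a receiver, so [canon] keeps [x]. *)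
- destruct H as [b L]; apply eqd_dom_valid in H0; simpl in H0; rewrite L in H0.
  destruct H0 as [(_ & _ & S) _]; destruct (label s) as [b' []|h'|]; simpl in S; tauto.
- now destruct H as [b ->].
(* The shape of [canon] on [DPar] depends on the label of the right component; [s] and [z] have
   equal labels because their canonical representatives coincide. *)
- apply eqd_doms in H, H0; destruct H as [Dx Dy], H0 as [Ds Dz].
  rewrite eqd_dom_valid in *.
  rewrite <- (label_canon (proj1 Ds)), <- (label_canon (proj1 Dz)), IHeqd1, IHeqd2; auto.
Qed.

Ltac dom := rewrite ?eqd_dom_valid in *; simpl in *;
  rewrite ?is_receive_Bro, ?is_receive_rel_act in *; intuition auto using unheard_Nil.

(** Each deletion is a generating clause of [eqd]; for compositions it first changes the context to
    [Nil], after which a congruence clause applies the induction hypothesis. *)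
Lemma eqd_to_canon (x : deriv) : eqd_dom x -> eqd defn x (canon x).
Proof.
induction x as [a P|x IHx y IHy|x IH Q|P y IH|x IH Q|P x IH|x IH f|x IH c|X x IH];
  intros D; assert (D' := eqd_dom_canon D); simpl in *.
- now apply eqd_refl.
- assert (Dc : valid (DPar x y) /\ ~ is_receive (label (DPar x y))) by now apply eqd_dom_valid.
  destruct Dc as [(Vx & Vy & S) N].
  destruct (label y) as [b' []|h'|] eqn:Ly.
  + destruct (label x) as [b s|h|] eqn:Lx; simpl in S; try contradiction.
    assert (Dy : eqd_dom y) by (rewrite eqd_dom_valid, Ly, is_receive_Bro; intuition discriminate).
    assert (eqd_dom (DParR Nil y))
      by (rewrite eqd_dom_valid; simpl; rewrite Ly, is_receive_Bro; repeat split; auto;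
          try discriminate; intros K; inversion K).
    eapply eqd_trans; [apply eqd_sendR with (P := Nil)|apply eqd_ParR]; auto.
    rewrite Ly; now exists b'.
  + destruct (label x) as [b s|h|] eqn:Lx; simpl in S; try contradiction.
    (* Two receivers would make the label of the composition a receive action, outside the domain of
       [eqd]. *)
    assert (s = Snd) as ->.
    { destruct s; auto; contradict N; simpl; rewrite Lx, Ly; simpl; now exists b. }
    assert (Dx : eqd_dom x) by (rewrite eqd_dom_valid, Lx, is_receive_Bro; intuition discriminate).
    assert (eqd_dom (DParL x Nil))
      by (rewrite eqd_dom_valid; simpl; rewrite Lx, is_receive_Bro; repeat split; auto;
          try discriminate; intros K; inversion K).
    eapply eqd_trans; [apply eqd_sendL with (P := Nil)|apply eqd_ParL]; auto.
    rewrite Lx; now exists b.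
  + apply eqd_Par; auto.
    * apply IHx; rewrite eqd_dom_valid; split; auto.
      destruct (label x); simpl in S; try contradiction; apply not_receive_Hs.
    * apply IHy; rewrite eqd_dom_valid, Ly; auto using not_receive_Hs.
  + destruct (label x); simpl in S; contradiction.
- assert (Dx : eqd_dom x) by dom; assert (eqd_dom (DParL x Nil)) by dom.
  eapply eqd_trans; [apply eqd_ParL_ctx with (Q := Nil)|apply eqd_ParL]; auto.
- assert (Dx : eqd_dom y) by dom; assert (eqd_dom (DParR Nil y)) by dom.
  eapply eqd_trans; [apply eqd_ParR_ctx with (Q := Nil)|apply eqd_ParR]; auto.
- assert (Dx : eqd_dom x) by dom.
  eapply eqd_trans; [apply eqd_SumL|]; auto.
- assert (Dx : eqd_dom x) by dom.
  eapply eqd_trans; [apply eqd_sym, eqd_SumR|]; auto.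
- assert (Dx : eqd_dom x) by dom; now apply eqd_Rel; auto.
- assert (Dx : eqd_dom x) by dom; now apply eqd_Res; auto.
- assert (Dx : eqd_dom x) by dom.
  eapply eqd_trans; [apply eqd_Rec|]; auto.
Qed.

(** Allows an abstract transition to be named by one derivation, on whose structure one can do
    induction. *)
Lemma eqd_iff_canon (x y : deriv) :
  eqd defn x y <-> eqd_dom x /\ eqd_dom y /\ canon x = canon y.
Proof.
split.
- intros H; assert (E := eqd_canon H); apply eqd_doms in H; tauto.
- intros (Dx & Dy & E); eapply eqd_trans; [now apply eqd_to_canon|].
  rewrite E; now apply eqd_sym, eqd_to_canon.
Qed.

(** * Concurrency and enabledness *)

Variant par_spec (x y : deriv) : deriv -> Prop :=
| par_sendL : is_send (label x) -> is_receive (label y) -> par_spec x y (DParL (canon x) Nil)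
| par_sendR : is_receive (label x) -> is_send (label y) -> par_spec x y (DParR Nil (canon y))
| par_comm h : label x = Hs B h -> label y = Hs B (bar h) ->
    par_spec x y (DPar (canon x) (canon y)).

Lemma parP (x y : deriv) : eqd_dom (DPar x y) -> par_spec x y (canon (DPar x y)).
Proof.
rewrite eqd_dom_valid; intros [(Vx & Vy & S) N]; simpl in *.
destruct (label x) as [b [] |h|] eqn:Lx, (label y) as [b' []|h'|] eqn:Ly; simpl in *;
  try tauto; try (destruct S; congruence).
- constructor; [rewrite Lx|rewrite Ly]; eexists; eauto.
- constructor; [rewrite Lx|rewrite Ly]; eexists; eauto.
- contradict N; now exists b.
- subst; econstructor; eauto.
Qed.

Lemma send_not_receive (a : act B C) : is_send a -> ~ is_receive a.
Proof. intros [b ->] [b' E]; discriminate. Qed.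

(* An occurrence of an abstract transition disables it, so that FG en(nu) and
   GF nu exclude each other. *)
Lemma conc_canon_neq (x y : deriv) :
  conc x y -> eqd_dom x -> canon x <> canon y.
Proof.
intros H; induction H; intros N.
(* [parP] shows which side the canonical form keeps. Clauses relating moves of opposite sides then
   differ in the outermost constructor; the others reduce to concurrent subderivations. *)
all: match goal with
  | N : eqd_dom (DPar ?x ?s) |- _ =>
      assert (W := N); apply eqd_dom_valid in W; simpl in W; destruct W as [(? & ? & ?) ?];
      destruct (parP N) as [K1 K2|K1 K2|h K1 K2]
  | _ => idtac end; simpl;
  try match goal with |- context [match label ?z with _ => _ end] =>
    destruct (label z) as [? []| |] end; try discriminate.
all: try (exfalso; eapply send_not_receive; eassumption).
all: try (exfalso; rewrite ?K1, ?K2 in *; eapply not_receive_Hs; eassumption).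
all: intros E; try (injection E; intros);
  match goal with IH : eqd_dom ?u -> ?l <> ?r, E : ?l = ?r |- _ => apply IH; [|exact E] end.
all: rewrite eqd_dom_valid in *; simpl in *; rewrite ?is_receive_rel_act in *; try tauto;
  split; try tauto; auto using send_not_receive; try rewrite K1; auto using not_receive_Hs.
all: rewrite ?K2; apply not_receive_Hs.
Qed.

(** Enabledness of the abstract transition whose canonical representative is [t]. *)
Definition enab (t : deriv) (u : ustate) : Prop :=
  exists x, eqd_dom x /\ canon x = t /\
    match u with UExpr P => src x = P | UDeriv z => conc x z end.

Definition valid_state (u : ustate) : Prop :=
  match u with UExpr _ => True | UDeriv z => valid z end.

Definition par_state (u v : ustate) : ustate :=
  match u, v with
  | UExpr P, UExpr Q => UExpr (Par P Q)
  | UDeriv x, UExpr Q => UDeriv (DParL x Q)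
  | UExpr P, UDeriv y => UDeriv (DParR P y)
  | UDeriv x, UDeriv y => UDeriv (DPar x y)
  end.

Definition res_state (c : hs C) (u : ustate) : ustate :=
  match u with UExpr P => UExpr (Res P c) | UDeriv x => UDeriv (DRes x c) end.

Definition rel_state (f : relabelling B C) (u : ustate) : ustate :=
  match u with UExpr P => UExpr (Rel P f) | UDeriv x => UDeriv (DRel x f) end.

(** A representative is enabled in a composition through the components that [canon] keeps. The
    [conc] clauses that leave a receiving component unconstrained do no harm, as that component is
    the one deleted. *)
Lemma enab_par_inv (t : deriv) (u v : ustate) :
  enab t (par_state u v) ->
  (exists t1, t = DParL t1 Nil /\ enab t1 u) \/
  (exists t2, t = DParR Nil t2 /\ enab t2 v) \/
  (exists t1 t2 h, t = DPar t1 t2 /\ enab t1 u /\ enab t2 v /\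
     label t1 = Hs B h /\ label t2 = Hs B (bar h)).
Proof.
intros (x & D & <- & H).
assert (S : exists P Q, src x = Par P Q).
{ destruct u, v; simpl in H; [eauto| | |]; inversion H; subst; simpl; eauto. }
assert (W := proj1 (eqd_dom_valid _) D); destruct W as [V N].
destruct S as (P & Q & S); destruct x as [|x y|x Q'|P' y| | | | |]; try discriminate S;
  simpl in V, N.
- destruct V as (Vx & Vy & _).
  destruct (parP D) as [K1 K2|K1 K2|h K1 K2].
  + left; exists (canon x); split; [reflexivity|]; exists x; split; [|split; [reflexivity|]].
    { rewrite eqd_dom_valid; auto using send_not_receive. }
    assert (K3 := send_not_receive K1).
    destruct u, v; simpl in *; [congruence|..]; inversion H; subst; auto; tauto.
  + right; left; exists (canon y); split; [reflexivity|]; exists y; split; [|split; [reflexivity|]].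
    { rewrite eqd_dom_valid; auto using send_not_receive. }
    assert (K3 := send_not_receive K2).
    destruct u, v; simpl in *; [congruence|..]; inversion H; subst; auto; tauto.
  + right; right; exists (canon x), (canon y), h; rewrite !label_canon by auto.
    assert (K3 : ~ is_receive (label x)) by (rewrite K1; apply not_receive_Hs).
    assert (K4 : ~ is_receive (label y)) by (rewrite K2; apply not_receive_Hs).
    split; [reflexivity|].
    split; [exists x|split; [exists y|auto]]; (split; [now rewrite eqd_dom_valid|split; [reflexivity|]]);
    destruct u, v; simpl in *; try congruence; inversion H; subst; auto; tauto.
- left; exists (canon x); split; [reflexivity|]; exists x; split; [|split; [reflexivity|]].
  { rewrite eqd_dom_valid; tauto. }
  destruct u, v; simpl in *; [congruence|..]; inversion H; subst; auto.
- right; left; exists (canon y); split; [reflexivity|]; exists y; split; [|split; [reflexivity|]].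
  { rewrite eqd_dom_valid; tauto. }
  destruct u, v; simpl in *; [congruence|..]; inversion H; subst; auto.
Qed.

Lemma enab_res_inv (t : deriv) (c : hs C) (u : ustate) :
  enab t (res_state c u) ->
  exists t1, t = DRes t1 c /\ enab t1 u /\ label t1 <> Hs B c /\ label t1 <> Hs B (bar c).
Proof.
intros (x & D & <- & H); apply eqd_dom_valid in D; destruct D as [V N].
assert (S : exists y, x = DRes y c).
{ destruct u; simpl in H; [destruct x; try discriminate H; injection H as <- <-; eauto|].
  inversion H; eauto. }
destruct S as [y ->]; simpl in V, N; destruct V as (V & V1 & V2).
exists (canon y); rewrite !label_canon by auto; repeat split; auto.
exists y; rewrite eqd_dom_valid; repeat split; auto.
destruct u; simpl in H; [congruence|now inversion H].
Qed.

Lemma enab_rel_inv (t : deriv) (f : relabelling B C) (u : ustate) :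
  enab t (rel_state f u) -> exists t1, t = DRel t1 f /\ enab t1 u.
Proof.
intros (x & D & <- & H); apply eqd_dom_valid in D; destruct D as [V N].
assert (S : exists y, x = DRel y f).
{ destruct u; simpl in H; [destruct x; try discriminate H; injection H as <- <-; eauto|].
  inversion H; eauto. }
destruct S as [y ->]; simpl in V, N; rewrite is_receive_rel_act in N.
exists (canon y); split; auto.
exists y; rewrite eqd_dom_valid; repeat split; auto.
destruct u; simpl in H; [congruence|now inversion H].
Qed.

Lemma enab_res (t : deriv) (c : hs C) (u : ustate) :
  valid_state (res_state c u) -> enab t u -> label t <> Hs B c -> label t <> Hs B (bar c) ->
  enab (DRes t c) (res_state c u).
Proof.
intros Vu (x & D & <- & H); apply eqd_dom_valid in D; destruct D as [V N].
rewrite !label_canon by auto; intros N1 N2.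
exists (DRes x c); rewrite eqd_dom_valid; repeat split; simpl; auto.
destruct u; simpl in *; [congruence|].
apply conc_Res; rewrite ?is_derivation_valid; simpl; auto.
Qed.

Lemma enab_rel (t : deriv) (f : relabelling B C) (u : ustate) :
  valid_state (rel_state f u) -> enab t u -> enab (DRel t f) (rel_state f u).
Proof.
intros Vu (x & D & <- & H); apply eqd_dom_valid in D; destruct D as [V N].
exists (DRel x f); rewrite eqd_dom_valid; simpl; rewrite is_receive_rel_act; repeat split; auto.
destruct u; simpl in *; [congruence|].
apply conc_Rel; rewrite ?is_derivation_valid; simpl; auto.
Qed.

Lemma enab_sync (t1 t2 : deriv) (h : hs C) (u v : ustate) :
  valid_state (par_state u v) -> enab t1 u -> enab t2 v ->
  label t1 = Hs B h -> label t2 = Hs B (bar h) ->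
  enab (DPar t1 t2) (par_state u v).
Proof.
intros W (x & Dx & <- & Hx) (y & Dy & <- & Hy).
apply eqd_dom_valid in Dx, Dy; destruct Dx as [Vx Nx], Dy as [Vy Ny].
rewrite !label_canon by auto; intros Lx Ly.
assert (V : valid (DPar x y)) by (simpl; rewrite Lx, Ly; simpl; auto).
exists (DPar x y); split; [|split].
- rewrite eqd_dom_valid; split; auto; simpl; rewrite Lx; apply not_receive_Tau.
- simpl; now rewrite Ly.
- destruct u, v; simpl in W, Hx, Hy |- *; [congruence|..].
  + apply conc_Par_ParR; auto; now apply is_derivation_valid.
  + apply conc_Par_ParL; auto; now apply is_derivation_valid.
  + apply conc_Par; auto; now apply is_derivation_valid.
Qed.

Section Receivers.

Hypothesis Hguarded : forall X, guarded (defn X).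

(** By coherence of [can_receive], either the rule for an idle context applies or there is a
    receiver to synchronise with. *)
Lemma heard_receiver (a : act B C) (Q : expr) : ~ is_receive a ->
  unheard a Q \/
  exists b s, a = Bro C b Snd /\ valid s /\ src s = Q /\ label s = Bro C b Rcv.
Proof.
intros N; destruct a as [b s|h|]; [|now left..].
assert (s = Snd) as -> by (destruct s; auto; contradict N; now exists b).
destruct (classic (can_receive defn Q b)) as [R|R]; [right|now left].
apply (can_receive_coherent Hguarded) in R; destruct R as (s & Q' & D).
exists b, s; split; [reflexivity|split].
- apply is_derivation_valid; do 3 eexists; exact D.
- apply derives_src_label_target in D; tauto.
Qed.

(** The representative is completed by idling or by a receiver on the right. That receiver need not
    be concurrent with the current move of the right component: the receiver clauses of [conc] only
    compare sources. *)
Lemma enab_left (t : deriv) (u v : ustate) :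
  valid_state (par_state u v) -> enab t u -> enab (DParL t Nil) (par_state u v).
Proof.
intros W (x & D & <- & H); apply eqd_dom_valid in D; destruct D as [V N].
(* The completed representative must start where the right component is, or where its current move
   started. *)
set (Q := match v with UExpr Q => Q | UDeriv z => src z end).
destruct (heard_receiver Q N) as [U|(b & s & Lx & Vs & Ss & Ls)].
- assert (Vd : valid (DParL x Q)) by (simpl; auto).
  exists (DParL x Q); split; [now rewrite eqd_dom_valid|split; [reflexivity|]].
  destruct u as [P|y], v as [Q0|z]; subst Q; simpl in W, H |- *; [congruence|..].
  + apply conc_lr; auto; now apply is_derivation_valid.
  + apply conc_ParL; auto; now apply is_derivation_valid.
  + apply conc_ParL_Par; auto; now apply is_derivation_valid.
- assert (Vd : valid (DPar x s)) by (simpl; rewrite Lx, Ls; simpl; repeat split; auto; discriminate).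
  assert (Rs : is_receive (label s)) by (rewrite Ls; now exists b).
  exists (DPar x s); split; [|split].
  + rewrite eqd_dom_valid; split; auto; simpl; rewrite Lx, Ls; simpl; rewrite is_receive_Bro; discriminate.
  + simpl; now rewrite Ls.
  + destruct u as [P|y], v as [Q0|z]; subst Q; simpl in W, H |- *; [congruence|..].
    * apply conc_recv_r; auto; now apply is_derivation_valid.
    * apply conc_Par_ParL; auto; now apply is_derivation_valid.
    * apply conc_Par_recv_r; auto; now apply is_derivation_valid.
Qed.

Lemma enab_right (t : deriv) (u v : ustate) :
  valid_state (par_state u v) -> enab t v -> enab (DParR Nil t) (par_state u v).
Proof.
intros W (x & D & <- & H); apply eqd_dom_valid in D; destruct D as [V N].
set (Q := match u with UExpr Q => Q | UDeriv z => src z end).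
destruct (heard_receiver Q N) as [U|(b & s & Lx & Vs & Ss & Ls)].
- assert (Vd : valid (DParR Q x)) by (simpl; auto).
  exists (DParR Q x); split; [now rewrite eqd_dom_valid|split; [reflexivity|]].
  destruct u as [P|y], v as [Q0|z]; subst Q; simpl in W, H |- *; [congruence|..].
  + apply conc_ParR; auto; now apply is_derivation_valid.
  + apply conc_rl; auto; now apply is_derivation_valid.
  + apply conc_ParR_Par; auto; now apply is_derivation_valid.
- assert (Vd : valid (DPar s x)) by (simpl; rewrite Lx, Ls; simpl; repeat split; auto; discriminate).
  assert (Rs : is_receive (label s)) by (rewrite Ls; now exists b).
  exists (DPar s x); split; [|split].
  + rewrite eqd_dom_valid; split; auto; simpl; rewrite Lx, Ls; simpl; rewrite is_receive_Bro; discriminate.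
  + simpl; now rewrite Lx.
  + destruct u as [P|y], v as [Q0|z]; subst Q; simpl in W, H |- *; [congruence|..].
    * apply conc_Par_ParR; auto; now apply is_derivation_valid.
    * apply conc_recv_l; auto; now apply is_derivation_valid.
    * apply conc_Par_recv_l; auto; now apply is_derivation_valid.
Qed.

End Receivers.

(** * Persistent enabledness and fairness *)

(** A derivation is never the last state of a path, and its outgoing edge certifies it. *)
Lemma upath_valid (q : sequence ustate) : is_upath defn q ->
  forall n u, q n = Some u -> valid_state u.
Proof.
intros (_ & _ & Hedge & Hfinal) n u Hu; destruct u as [P|x]; simpl; auto.
destruct (q (1 + n)) as [v|] eqn:Hv.
- assert (E := Hedge _ _ _ Hu Hv); inversion E; subst; now apply is_derivation_valid.
- destruct (Hfinal _ _ Hu Hv); discriminate.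
Qed.

Lemma hat_upath (q : sequence ustate) : is_upath defn q -> is_spath defn (hat_path q).
Proof.
intros Hq; assert (V := upath_valid Hq); destruct Hq as (H0 & H1 & H2 & H3).
assert (O : forall n, occurs (hat_path q) n <-> occurs q n).
{ intros n; unfold occurs, hat_path; destruct (q n); simpl; split; congruence. }
repeat split.
- now apply O.
- intros n; rewrite !O; auto.
- intros n s t; unfold hat_path; destruct (q n) as [u|] eqn:Hu; [|discriminate].
  destruct (q (1 + n)) as [v|] eqn:Hv; [|discriminate]; simpl.
  intros [= <-] [= <-]; destruct (H2 _ _ _ Hu Hv) as [x D|x D]; simpl;
    apply is_derivation_valid, valid_derives in D; constructor; now exists x.
- intros n s; unfold hat_path; destruct (q n) as [u|] eqn:Hu; [|discriminate].
  destruct (q (1 + n)) as [v|] eqn:Hv; [discriminate|]; simpl.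
  intros [= <-] _; destruct (H3 _ _ Hu Hv) as [P ->]; now exists P.
Qed.

(** On a finite path this amounts to enabledness in the last state. *)
Definition persistent (t : deriv) (q : sequence ustate) : Prop :=
  exists N, occurs q N /\ forall n u, N <= n -> q n = Some u -> enab t u.

Definition fair (Y : hset C) (q : sequence ustate) : Prop :=
  forall t, persistent t q -> exists h, label t = Hs B h /\ Y h.

Definition fair_just (Y : hset C) (p : sequence sstate) : Prop :=
  exists q, is_upath defn q /\ p = hat_path q /\ fair Y q.

(** * Projections of paths and closure properties of fairness *)

Definition left_state (u : ustate) : ustate :=
  match u with
  | UExpr (Par P _) | UDeriv (DParR P _) => UExpr P
  | UDeriv (DPar x _) | UDeriv (DParL x _) => UDeriv x
  | _ => u
  end.

Definition right_state (u : ustate) : ustate :=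
  match u with
  | UExpr (Par _ Q) | UDeriv (DParL _ Q) => UExpr Q
  | UDeriv (DPar _ y) | UDeriv (DParR _ y) => UDeriv y
  | _ => u
  end.

(** The default values of the projections make this equation fail outside parallel compositions. *)
Definition is_par_state (u : ustate) : Prop := u = par_state (left_state u) (right_state u).

(** The step hypotheses of [destutter] for both projections; in particular a component stands still
    only in an expression. *)
Lemma uedge_par (u v : ustate) : uedge defn u v -> is_par_state u ->
  is_par_state v /\
  (left_state u = left_state v \/ uedge defn (left_state u) (left_state v)) /\
  (right_state u = right_state v \/ uedge defn (right_state u) (right_state v)) /\
  (ufinal (left_state u) \/ left_state u <> left_state v) /\
  (ufinal (right_state u) \/ right_state u <> right_state v).
Proof.
unfold is_par_state, ufinal.
intros E; destruct E as [x D|x D]; apply is_derivation_valid in D;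
  destruct x; simpl in *; intros H; try discriminate H; split; auto;
  repeat split;
  solve [auto | left; eauto | right; discriminate
    | right; constructor; apply is_derivation_valid; tauto].
Qed.

Lemma upath_par (q : sequence ustate) (P Q : expr) :
  is_upath defn q -> q 0 = Some (UExpr (Par P Q)) ->
  forall n u, q n = Some u -> is_par_state u.
Proof.
intros (_ & H1 & H2 & _) H0 n; induction n as [|n IH]; intros u Hu.
- rewrite H0 in Hu; injection Hu as <-; reflexivity.
- destruct (proj1 (occurs_Some q n)) as [v Hv].
  { apply H1; simpl; unfold occurs; congruence. }
  exact (proj1 (uedge_par (H2 _ _ _ Hv Hu) (IH _ Hv))).
Qed.

Lemma hat_par_state (u : ustate) : is_par_state u -> valid_state u ->
  dec_par_state defn (hat u) (hat (left_state u)) (hat (right_state u)).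
Proof.
unfold is_par_state; destruct u as [P|x]; [destruct P|destruct x]; intros H V;
  try discriminate H; simpl in V |- *; constructor; now apply is_derivation_valid.
Qed.

(** Destuttering both projections, since a component repeats its expression while the other one
    moves alone. *)
Lemma upath_decomp_par (q : sequence ustate) (P Q : expr) :
  is_upath defn q -> q 0 = Some (UExpr (Par P Q)) ->
  exists q1 q2 l r,
    is_upath defn q1 /\ is_upath defn q2 /\ slow l /\ slow r /\
    (forall m, occurs q1 m -> exists n, occurs q n /\ l n = m) /\
    (forall m, occurs q2 m -> exists n, occurs q n /\ r n = m) /\
    forall n u, q n = Some u ->
      q1 (l n) = Some (left_state u) /\ q2 (r n) = Some (right_state u).
Proof.
intros Hq H0; assert (par := upath_par Hq H0); destruct Hq as (G0 & G1 & G2 & G3).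
assert (E : forall n s t, q n = Some s -> q (1 + n) = Some t -> uedge defn s t /\ is_par_state s)
  by eauto.
assert (F : forall n s, q n = Some s -> q (1 + n) = None ->
  ufinal (left_state s) /\ ufinal (right_state s)).
{ intros n s Hs Ht; assert (K := par _ _ Hs); destruct (G3 _ _ Hs Ht) as [R ->].
  destruct R; try discriminate K; simpl; split; eexists; reflexivity. }
destruct (@destutter _ _ (uedge defn) (@ufinal A B C) q left_state) as (q1 & l & K1); auto.
{ intros n s t Hs Ht; destruct (E _ _ _ Hs Ht) as [K L]; destruct (uedge_par K L); tauto. }
{ intros n s t Hs Ht; destruct (E _ _ _ Hs Ht) as [K L]; destruct (uedge_par K L); tauto. }
{ intros n s Hs Ht; destruct (F _ _ Hs Ht); auto. }
destruct (@destutter _ _ (uedge defn) (@ufinal A B C) q right_state) as (q2 & r & K2); auto.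
{ intros n s t Hs Ht; destruct (E _ _ _ Hs Ht) as [K L]; destruct (uedge_par K L); tauto. }
{ intros n s t Hs Ht; destruct (E _ _ _ Hs Ht) as [K L]; destruct (uedge_par K L); tauto. }
{ intros n s Hs Ht; destruct (F _ _ Hs Ht); auto. }
destruct K1 as (A1 & A2 & A3 & A4), K2 as (B1 & B2 & B3 & B4).
exists q1, q2, l, r; do 6 (split; [assumption|]); auto.
Qed.

(** A non-receiving transition enabled in the last state of a finite path is persistently enabled,
    so fairness restricts its label. *)
Lemma fair_just_finite (Y : hset C) (p : sequence sstate) : fair_just Y p ->
  forall n P, p n = Some (SExpr P) -> p (1 + n) = None ->
  forall a Q, transition defn P a Q -> in_Y_or_receive Y a.
Proof.
intros (q & Hq & -> & F) n P Hn Hn' a Q [x D].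
destruct (classic (is_receive a)) as [R|R]; [now right|left].
assert (V : valid x) by (apply is_derivation_valid; do 3 eexists; exact D).
apply derives_src_label_target in D; destruct D as (<- & <- & <-).
unfold hat_path in Hn, Hn'; destruct (q n) as [u|] eqn:Hu; [|discriminate].
destruct (q (1 + n)) eqn:Hv; [discriminate|].
rewrite <- label_canon by auto; apply F.
exists n; split; [unfold occurs; congruence|].
intros m v L Hm; assert (m = n) as ->.
{ destruct (PeanoNat.Nat.eq_dec m n) as [|N]; auto; exfalso.
  apply (occurs_le (p := q)) with (n := 1 + n) (m := m); [apply Hq|lia| |auto].
  unfold occurs; congruence. }
exists x; rewrite eqd_dom_valid; repeat split; auto.
rewrite Hu in Hm; injection Hm as <-.
destruct u; simpl in Hn; [congruence|discriminate].
Qed.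

Lemma fair_just_suffix (Y : hset C) (p : sequence sstate) : fair_just Y p ->
  forall n, occurs p n -> fair_just Y (suffix n p).
Proof.
intros (q & Hq & -> & F) n O; exists (suffix n q).
assert (Oq : occurs q n) by (unfold occurs, hat_path in *; destruct (q n); simpl in *; congruence).
split; [now apply suffix_path|split; [reflexivity|]].
intros t (N & ON & H); apply F; exists (n + N); split; auto.
intros m u L Hm; apply (H (m - n)); [lia|].
unfold suffix; now replace (n + (m - n)) with m by lia.
Qed.

(** Shared by restriction and relabelling: the path never leaves the wrapper, which is injective and
    can be peeled off position by position, without destuttering. *)
Lemma fair_just_unary (dec : sstate -> sstate -> Prop) (wrap : ustate -> ustate)
    (Y : hset C) (q : sequence ustate) (P : expr) :
  (forall u v, uedge defn (wrap u) v -> exists w, v = wrap w /\ uedge defn u w) ->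
  (forall u, ufinal (wrap u) -> ufinal u) ->
  (forall u, valid_state (wrap u) -> dec (hat (wrap u)) (hat u)) ->
  (forall u v, wrap u = wrap v -> u = v) ->
  (forall q1, (forall n, q n = option_map wrap (q1 n)) -> fair Y q1) ->
  is_upath defn q -> q 0 = Some (wrap (UExpr P)) ->
  exists p1, decomp_unary defn dec (hat_path q) p1 /\ fair_just Y p1.
Proof.
intros He Hf Hd Hi HF Hq H0; assert (V := upath_valid Hq).
assert (W : forall n v, q n = Some v -> exists u, v = wrap u).
{ destruct Hq as (_ & H1 & H2 & _); intros n; induction n as [|n IH]; intros v Hv.
  - exists (UExpr P); congruence.
  - destruct (proj1 (occurs_Some q n)) as [v' Hv'].
    { apply H1; simpl; unfold occurs; congruence. }
    destruct (IH _ Hv') as [u ->]; destruct (He _ _ (H2 _ _ _ Hv' Hv)) as (w & -> & _); eauto. }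
assert (W' : forall n, exists o, q n = option_map wrap o).
{ intros n; destruct (q n) as [v|] eqn:Hv; [|now exists None].
  destruct (W _ _ Hv) as [u ->]; now exists (Some u). }
set (q1 n := epsilon (inhabits None) (fun o => q n = option_map wrap o)).
assert (E : forall n, q n = option_map wrap (q1 n)) by (intros n; apply epsilon_spec, W').
clearbody q1.
assert (O : forall n, occurs q1 n <-> occurs q n).
{ intros n; unfold occurs; rewrite E; destruct (q1 n); simpl; split; congruence. }
assert (Hq1 : is_upath defn q1).
{ destruct Hq as (G0 & G1 & G2 & G3); repeat split.
  - now apply O.
  - intros n; rewrite !O; auto.
  - intros n s t Hs Ht.
    destruct (He s (wrap t)) as (w & K & L).
    + apply (G2 n); rewrite E; [now rewrite Hs|now rewrite Ht].
    + now rewrite (Hi _ _ K).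
  - intros n s Hs Ht; apply Hf, (G3 n); rewrite E; [now rewrite Hs|now rewrite Ht]. }
exists (hat_path q1); split.
- split; [now apply hat_upath|]; intros n; unfold hat_path.
  destruct (q n) as [v|] eqn:Hv; assert (Ev := Hv); rewrite E in Ev;
    destruct (q1 n) as [u|]; try discriminate Ev; simpl; auto.
  injection Ev as <-; now apply Hd, (V n).
- exists q1; auto.
Qed.

(** Surjectivity of the position map finds a position of the composed path at which the component
    has reached its persistent phase; monotonicity keeps it there, even if the component has
    stopped. *)
Lemma persistent_component (c : ustate -> ustate) (q q1 : sequence ustate) (l : nat -> nat) t :
  slow l -> (forall m, occurs q1 m -> exists n, occurs q n /\ l n = m) ->
  (forall n u, q n = Some u -> q1 (l n) = Some (c u)) ->
  persistent t q1 ->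
  exists N, occurs q N /\ forall n u, N <= n -> q n = Some u -> enab t (c u).
Proof.
intros Hl Hs Hc (M & O & H); destruct (Hs _ O) as (N & ON & <-).
exists N; split; auto; intros n u L Hu; apply (H (l n)); auto.
now apply slow_mono.
Qed.

(** * Fair paths form a justness family *)

Section FairImpliesJust.

Hypothesis Hguarded : forall X, guarded (defn X).

Lemma fair_just_par (Y : hset C) (p : sequence sstate) : fair_just Y p ->
  forall P Q, p 0 = Some (SExpr (Par P Q)) ->
  exists (p1 p2 : sequence sstate) (X Z : hset C),
    decomp_par defn p p1 p2 /\ fair_just X p1 /\ fair_just Z p2 /\
    (forall h, X h \/ Z h -> Y h) /\
    (forall h, ~ (X h /\ Z (bar h))).
Proof.
intros (q & Hq & -> & F) P Q H0.
assert (Hq0 : q 0 = Some (UExpr (Par P Q))).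
{ unfold hat_path in H0; destruct (q 0) as [[R|x]|]; try discriminate; simpl in H0; congruence. }
destruct (upath_decomp_par Hq Hq0) as (q1 & q2 & l & r & Hq1 & Hq2 & Hl & Hr & Sl & Sr & D).
assert (par := upath_par Hq Hq0); assert (V := upath_valid Hq).
assert (D1 : forall n u, q n = Some u -> q1 (l n) = Some (left_state u)) by apply D.
assert (D2 : forall n u, q n = Some u -> q2 (r n) = Some (right_state u)) by apply D.
(* Enabledness in a component carries over to the composition whatever the other component does. *)
assert (L1 : forall t, persistent t q1 -> persistent (DParL t Nil) q).
{ intros t H; destruct (persistent_component Hl Sl D1 H) as (N & O & K).
  exists N; split; auto; intros n u Ln Hu.
  rewrite (par _ _ Hu); apply enab_left; eauto; rewrite <- (par _ _ Hu); eauto. }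
assert (L2 : forall t, persistent t q2 -> persistent (DParR Nil t) q).
{ intros t H; destruct (persistent_component Hr Sr D2 H) as (N & O & K).
  exists N; split; auto; intros n u Ln Hu.
  rewrite (par _ _ Hu); apply enab_right; eauto; rewrite <- (par _ _ Hu); eauto. }
assert (T : forall q' l', (forall n u, q n = Some u -> exists v, q' (l' n) = Some v) -> slow l' ->
  (forall m, occurs q' m -> exists n, occurs q n /\ l' n = m) ->
  tracks (hat_path q) (hat_path q') l').
{ intros q' l' K [K0 KS] Ks; repeat split; auto.
  intros m O; destruct (Ks m) as (n & On & E).
  - unfold occurs, hat_path in *; destruct (q' m); simpl in *; congruence.
  - exists n; split; auto; unfold occurs, hat_path in *; destruct (q n); simpl in *; congruence. }
exists (hat_path q1), (hat_path q2),
  (fun h => exists t, label t = Hs B h /\ persistent t q1),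
  (fun h => exists t, label t = Hs B h /\ persistent t q2).
split; [|split; [|split; [|split]]].
- split; [now apply hat_upath|split; [now apply hat_upath|]].
  exists l, r; split; [apply T; eauto|split; [apply T; eauto|]].
  intros n s Hs; unfold hat_path in *; destruct (q n) as [u|] eqn:Hu; [|discriminate].
  injection Hs as <-; exists (hat (left_state u)), (hat (right_state u)).
  rewrite (D1 _ _ Hu), (D2 _ _ Hu); repeat split; apply hat_par_state; eauto.
(* [DParL t Nil] has the label of [t], so fairness of [q] makes that label a handshake. *)
- exists q1; split; auto; split; auto; intros t H.
  destruct (F _ (L1 _ H)) as (h & E & _); simpl in E; eauto.
- exists q2; split; auto; split; auto; intros t H.
  destruct (F _ (L2 _ H)) as (h & E & _); simpl in E; eauto.
- intros h [(t & E & H)|(t & E & H)].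
  + destruct (F _ (L1 _ H)) as (h' & E' & Yh); simpl in E'; congruence.
  + destruct (F _ (L2 _ H)) as (h' & E' & Yh); simpl in E'; congruence.
- intros h [(t1 & E1 & H1) (t2 & E2 & H2)].
  destruct (persistent_component Hl Sl D1 H1) as (N1 & O1 & K1).
  destruct (persistent_component Hr Sr D2 H2) as (N2 & O2 & K2).
  (* From [max N1 N2] on both handshakes are enabled, so their synchronisation persists; its label
     is [Tau], which fairness forbids. *)
  destruct (F (DPar t1 t2)) as (h' & E' & _).
  + exists (max N1 N2); split.
    * destruct (PeanoNat.Nat.max_spec N1 N2) as [[_ ->]|[_ ->]]; auto.
    * intros n u L Hu; rewrite (par _ _ Hu); apply (@enab_sync _ _ h); auto.
      -- rewrite <- (par _ _ Hu); eauto.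
      -- apply (K1 n); auto; lia.
      -- apply (K2 n); auto; lia.
  + simpl in E'; rewrite E1 in E'; discriminate.
Qed.

Lemma fair_just_res (Y : hset C) (p : sequence sstate) : fair_just Y p ->
  forall P c, p 0 = Some (SExpr (Res P c)) ->
  exists p1, decomp_unary defn (dec_res_state defn c) p p1 /\
    fair_just (fun h => Y h \/ h = c \/ h = bar c) p1.
Proof.
intros (q & Hq & -> & F) P c H0.
apply (@fair_just_unary (dec_res_state defn c) (res_state c) _ q P); auto.
- intros [R|x] v E; inversion E as [x' D|x' D]; subst.
  + destruct x' as [| | | | | | |x' c'|]; try discriminate; simpl in H; injection H as <- <-.
    exists (UDeriv x'); split; [reflexivity|constructor].
    apply is_derivation_valid; apply is_derivation_valid in D; apply D.
  + exists (UExpr (target x)); split; [reflexivity|constructor].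
    apply is_derivation_valid; apply is_derivation_valid in D; apply D.
- intros [R|x] [S E]; [now exists R|discriminate].
- intros [R|x]; simpl; [constructor|].
  intros V; constructor; now apply is_derivation_valid.
- intros [R|x] [S|y] E; simpl in E; congruence.
- intros q1 E t (N & O & H).
  (* Labels that the restriction blocks were added to [Y]; all other transitions survive under
     it. *)
  destruct (classic (label t = Hs B c)) as [Lc|Lc]; [eauto|].
  destruct (classic (label t = Hs B (bar c))) as [Lc'|Lc']; [eauto|].
  destruct (F (DRes t c)) as (h & Lh & Yh); [|eauto].
  exists N; split; [unfold occurs in *; rewrite E; destruct (q1 N); simpl in *; congruence|].
  intros n u L Hu; assert (V := upath_valid Hq Hu); rewrite E in Hu.
  destruct (q1 n) as [v|] eqn:Hv; [|discriminate]; injection Hu as <-.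
  apply enab_res; eauto.
- unfold hat_path in H0; destruct (q 0) as [[R|x]|]; try discriminate; simpl in *; congruence.
Qed.

Lemma fair_just_rel (Y : hset C) (p : sequence sstate) : fair_just Y p ->
  forall P f, p 0 = Some (SExpr (Rel P f)) ->
  exists p1, decomp_unary defn (dec_rel_state defn f) p p1 /\
    fair_just (fun h => Y (rel_hs f h)) p1.
Proof.
intros (q & Hq & -> & F) P f H0.
apply (@fair_just_unary (dec_rel_state defn f) (rel_state f) _ q P); auto.
- intros [R|x] v E; inversion E as [x' D|x' D]; subst.
  + destruct x' as [| | | | | |x' f'| |]; try discriminate; simpl in H; injection H as <- <-.
    exists (UDeriv x'); split; [reflexivity|constructor].
    apply is_derivation_valid; apply is_derivation_valid in D; apply D.
  + exists (UExpr (target x)); split; [reflexivity|constructor].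
    apply is_derivation_valid; apply is_derivation_valid in D; apply D.
- intros [R|x] [S E]; [now exists R|discriminate].
- intros [R|x]; simpl; [constructor|].
  intros V; constructor; now apply is_derivation_valid.
- intros [R|x] [S|y] E; simpl in E; congruence.
- intros q1 E t (N & O & H).
  destruct (F (DRel t f)) as (h & Lh & Yh).
  + exists N; split; [unfold occurs in *; rewrite E; destruct (q1 N); simpl in *; congruence|].
    intros n u L Hu; assert (V := upath_valid Hq Hu); rewrite E in Hu.
    destruct (q1 n) as [v|] eqn:Hv; [|discriminate]; injection Hu as <-.
    apply enab_rel; eauto.
  (* Only a handshake is relabelled to a handshake. *)
  + simpl in Lh; destruct (label t) as [b s|k|]; try discriminate.
    injection Lh as <-; eauto.
- unfold hat_path in H0; destruct (q 0) as [[R|x]|]; try discriminate; simpl in *; congruence.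
Qed.

Lemma fair_just_family : just_family defn fair_just.
Proof.
split.
- intros Y p (q & Hq & -> & _); now apply hat_upath.
- apply fair_just_finite.
- apply fair_just_par.
- apply fair_just_res.
- apply fair_just_rel.
- apply fair_just_suffix.
Qed.

End FairImpliesJust.

(** * Resolving a just path into derivations *)

(** [dec_par_state] refers to some derivations of the component transitions. The side conditions
    depend on sources and labels only, so any other derivations of the same transitions compose as
    well. *)
Lemma dec_par_state_hat (s : sstate) (u v : ustate) :
  dec_par_state defn s (hat u) (hat v) -> valid_state u -> valid_state v ->
  s = hat (par_state u v) /\ valid_state (par_state u v).
Proof.
intros H Vu Vv; inversion H as [P Q E1 E2 E3|x Q D E1 E2 E3|x y D E1 E2 E3|P y D E1 E2 E3];
  destruct u as [P'|x'], v as [Q'|y']; try discriminate;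
  simpl in *; unfold hat_deriv in *; simpl in *; try apply is_derivation_valid in D; simpl in *.
- split; auto; congruence.
- injection E2 as S1 L1 T1; injection E3 as ->; rewrite S1, L1, T1 in *; tauto.
- injection E2 as S1 L1 T1; injection E3 as S2 L2 T2.
  rewrite S1, L1, T1, S2, L2, T2 in *; tauto.
- injection E2 as ->; injection E3 as S1 L1 T1; rewrite S1, L1, T1 in *; tauto.
Qed.

Lemma dec_res_state_hat (c : hs C) (s : sstate) (u : ustate) :
  dec_res_state defn c s (hat u) -> valid_state u ->
  s = hat (res_state c u) /\ valid_state (res_state c u).
Proof.
intros H Vu; inversion H as [P E1 E2|x D E1 E2]; destruct u as [P'|x']; try discriminate;
  simpl in *; unfold hat_deriv in *; simpl in *; try apply is_derivation_valid in D; simpl in *.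
- split; auto; congruence.
- injection E2 as S1 L1 T1; rewrite S1, L1, T1 in *; tauto.
Qed.

Lemma dec_rel_state_hat (f : relabelling B C) (s : sstate) (u : ustate) :
  dec_rel_state defn f s (hat u) -> valid_state u ->
  s = hat (rel_state f u) /\ valid_state (rel_state f u).
Proof.
intros H Vu; inversion H as [P E1 E2|x D E1 E2]; destruct u as [P'|x']; try discriminate;
  simpl in *; unfold hat_deriv in *; simpl in *; try apply is_derivation_valid in D; simpl in *.
- split; auto; congruence.
- injection E2 as S1 L1 T1; rewrite S1, L1, T1 in *; tauto.
Qed.

Record par_split : Type := ParSplit {
  split1 : sequence sstate; split2 : sequence sstate;
  splitX : hset C; splitZ : hset C;
  splitl : nat -> nat; splitr : nat -> nat }.

Definition par_split_of (Y : hset C) (p : sequence sstate) (d : par_split) : Prop :=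
  tracks p (split1 d) (splitl d) /\ tracks p (split2 d) (splitr d) /\
  (forall n s, p n = Some s -> exists s1 s2,
     split1 d (splitl d n) = Some s1 /\ split2 d (splitr d n) = Some s2 /\
     dec_par_state defn s s1 s2) /\
  Y_just defn (splitX d) (split1 d) /\ Y_just defn (splitZ d) (split2 d) /\
  (forall h, splitX d h \/ splitZ d h -> Y h) /\
  (forall h, ~ (splitX d h /\ splitZ d (bar h))).

Definition nilseq : sequence sstate := fun _ => None.

(** Chosen once for each [Y] and [p], so that readings of different positions refer to the same
    component paths. *)
Definition the_par_split (Y : hset C) (p : sequence sstate) : par_split :=
  epsilon (inhabits (ParSplit nilseq nilseq (fun _ => False) (fun _ => False) id id))
    (par_split_of Y p).

Lemma the_par_split_spec (Y : hset C) (p : sequence sstate) (P Q : expr) :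
  Y_just defn Y p -> p 0 = Some (SExpr (Par P Q)) -> par_split_of Y p (the_par_split Y p).
Proof.
intros J H0; unfold the_par_split; apply epsilon_spec.
destruct (jf_par (proj1 (Y_just_largest defn)) J H0) as (p1 & p2 & X & Z & D & J1 & J2 & K1 & K2).
destruct D as (_ & _ & l & r & Tl & Tr & D).
exists (ParSplit p1 p2 X Z l r); repeat (split; [assumption|]); assumption.
Qed.

Definition res_hset (c : hs C) (Y : hset C) : hset C := fun h => Y h \/ h = c \/ h = bar c.
Definition rel_hset (f : relabelling B C) (Y : hset C) : hset C := fun h => Y (rel_hs f h).

Definition res_split_of (c : hs C) (Y : hset C) (p p1 : sequence sstate) : Prop :=
  decomp_unary defn (dec_res_state defn c) p p1 /\ Y_just defn (res_hset c Y) p1.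

Definition rel_split_of (f : relabelling B C) (Y : hset C) (p p1 : sequence sstate) : Prop :=
  decomp_unary defn (dec_rel_state defn f) p p1 /\ Y_just defn (rel_hset f Y) p1.

Definition the_res_split c Y p := epsilon (inhabits nilseq) (res_split_of c Y p).
Definition the_rel_split f Y p := epsilon (inhabits nilseq) (rel_split_of f Y p).

Lemma the_res_split_spec (Y : hset C) (p : sequence sstate) (P : expr) (c : hs C) :
  Y_just defn Y p -> p 0 = Some (SExpr (Res P c)) -> res_split_of c Y p (the_res_split c Y p).
Proof.
intros J H0; unfold the_res_split; apply epsilon_spec; exact (jf_res (proj1 (Y_just_largest defn)) J H0).
Qed.

Lemma the_rel_split_spec (Y : hset C) (p : sequence sstate) (P : expr) (f : relabelling B C) :
  Y_just defn Y p -> p 0 = Some (SExpr (Rel P f)) -> rel_split_of f Y p (the_rel_split f Y p).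
Proof.
intros J H0; unfold the_rel_split; apply epsilon_spec; exact (jf_rel (proj1 (Y_just_largest defn)) J H0).
Qed.

Definition composed (s : sstate) : Prop :=
  match s with SExpr (Par _ _) | SExpr (Res _ _) | SExpr (Rel _ _) => True | _ => False end.

(* [resolves Y p n u]: the state [u] of U is a way to read position [n] of the
   Y-just path [p] that respects the decompositions fixed above. As long as the
   path has not reached a parallel composition, restriction or relabelling,
   any derivation of its transitions will do. *)
Inductive resolves : hset C -> sequence sstate -> nat -> ustate -> Prop :=
| resolves_here Y p s u :
    p 0 = Some s -> ~ composed s -> hat u = s -> valid_state u -> resolves Y p 0 u
| resolves_later Y p s n u :
    p 0 = Some s -> ~ composed s -> resolves Y (suffix 1 p) n u -> resolves Y p (1 + n) u
| resolves_par Y p P Q d n u v :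
    p 0 = Some (SExpr (Par P Q)) -> d = the_par_split Y p ->
    resolves (splitX d) (split1 d) (splitl d n) u ->
    resolves (splitZ d) (split2 d) (splitr d n) v ->
    resolves Y p n (par_state u v)
| resolves_res Y p P c n u :
    p 0 = Some (SExpr (Res P c)) ->
    resolves (res_hset c Y) (the_res_split c Y p) n u ->
    resolves Y p n (res_state c u)
| resolves_rel Y p P f n u :
    p 0 = Some (SExpr (Rel P f)) ->
    resolves (rel_hset f Y) (the_rel_split f Y p) n u ->
    resolves Y p n (rel_state f u).

Lemma Y_just_path (Y : hset C) (p : sequence sstate) : Y_just defn Y p -> is_spath defn p.
Proof. exact (jf_path (proj1 (Y_just_largest defn)) (Y := Y) (p := p)). Qed.

Lemma Y_just_suffix (Y : hset C) (p : sequence sstate) (n : nat) :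
  Y_just defn Y p -> occurs p n -> Y_just defn Y (suffix n p).
Proof. intros J; exact (jf_suffix (proj1 (Y_just_largest defn)) J (n := n)). Qed.

Lemma decomp_unary_Some (dec : sstate -> sstate -> Prop) (p p1 : sequence sstate) :
  decomp_unary defn dec p p1 -> forall n s, p n = Some s -> exists s1, p1 n = Some s1 /\ dec s s1.
Proof.
intros [_ D] n s Hs; specialize (D n); rewrite Hs in D; destruct (p1 n); [eauto|contradiction].
Qed.

Lemma resolves_hat (Y : hset C) (p : sequence sstate) (n : nat) (u : ustate) :
  resolves Y p n u -> Y_just defn Y p -> forall s, p n = Some s ->
  s = hat u /\ valid_state u.
Proof.
intros R; induction R as [Y p s u H0 N E V|Y p s n u H0 N R IH|Y p P Q d n u v H0 Hd R1 IH1 R2 IH2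
  |Y p P c n u H0 R IH|Y p P f n u H0 R IH]; intros J s' Hs.
- split; auto; congruence.
- apply IH; [|exact Hs]; apply Y_just_suffix; auto.
  destruct (Y_just_path J) as (_ & K & _ & _).
  apply (occurs_le K (n := 1) (m := 1 + n)); [lia|unfold occurs; congruence].
- assert (S := the_par_split_spec J H0); rewrite <- Hd in S.
  destruct S as (_ & _ & D & J1 & J2 & _ & _).
  destruct (D _ _ Hs) as (s1 & s2 & H1 & H2 & K).
  destruct (IH1 J1 _ H1) as [-> V1], (IH2 J2 _ H2) as [-> V2].
  now apply dec_par_state_hat.
- destruct (the_res_split_spec J H0) as [D J1].
  destruct (decomp_unary_Some D Hs) as (s1 & H1 & K).
  destruct (IH J1 _ H1) as [-> V]; now apply dec_res_state_hat.
- destruct (the_rel_split_spec J H0) as [D J1].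
  destruct (decomp_unary_Some D Hs) as (s1 & H1 & K).
  destruct (IH J1 _ H1) as [-> V]; now apply dec_rel_state_hat.
Qed.

Lemma tracks_slow (p p1 : sequence sstate) (l : nat -> nat) : tracks p p1 l -> slow l.
Proof. intros (H0 & H1 & _); now split. Qed.

Lemma hat_surjective (p : sequence sstate) (s : sstate) (n : nat) :
  is_spath defn p -> p n = Some s -> exists u, hat u = s /\ valid_state u.
Proof.
intros (_ & _ & He & Hf) Hs; destruct s as [P|P a Q].
- now exists (UExpr P).
- assert (T : transition defn P a Q).
  { destruct (p (1 + n)) as [t|] eqn:Ht.
    - assert (K := He _ _ _ Hs Ht); now inversion K.
    - destruct (Hf _ _ Hs Ht); discriminate. }
  destruct T as [x D]; exists (UDeriv x); split.
  + apply derives_src_label_target in D; destruct D as (<- & <- & <-); reflexivity.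
  + apply is_derivation_valid; do 3 eexists; exact D.
Qed.

(** Before a composition is reached, strong induction on the position applies to a suffix. At a
    composition the components are followed by structural induction on the starting expression;
    their positions do not exceed [n] by [slow_le]. *)
Lemma resolves_total (n : nat) :
  forall Y p, Y_just defn Y p -> occurs p n -> exists u, resolves Y p n u.
Proof.
induction n as [n IHn] using Wf_nat.lt_wf_ind.
assert (static : forall Y p m s, m <= n -> Y_just defn Y p -> p 0 = Some s -> ~ composed s ->
  occurs p m -> exists u, resolves Y p m u).
{ intros Y p [|m] s L J H0 N O.
  - destruct (hat_surjective (Y_just_path J) H0) as (u & E & V).
    exists u; eapply resolves_here; eauto.
  - destruct (IHn m) with (Y := Y) (p := suffix 1 p) as [u R]; [lia| |exact O|].
    + apply Y_just_suffix; auto.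
      destruct (Y_just_path J) as (_ & K & _ & _).
      apply (occurs_le K (n := 1) (m := 1 + m)); [lia|exact O].
    + exists u; eapply resolves_later; eauto. }
assert (dyn : forall P Y p m, m <= n -> Y_just defn Y p -> p 0 = Some (SExpr P) -> occurs p m ->
  exists u, resolves Y p m u).
{ induction P as [|a E _|E _ F _|E IHE F IHF|E IH c|E IH f|X]; intros Y p m L J H0 O;
    try (apply (static Y p m _ L J H0); [now simpl|exact O]);
    assert (O' := O); apply occurs_Some in O'; destruct O' as [s Hs].
  - assert (S := the_par_split_spec J H0); set (d := the_par_split Y p) in *.
    destruct S as (Tl & Tr & D & J1 & J2 & _ & _).
    destruct (D _ _ H0) as (s1 & s2 & K1 & K2 & K).
    rewrite (proj1 Tl) in K1; rewrite (proj1 Tr) in K2; inversion K; subst.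
    destruct (D _ _ Hs) as (t1 & t2 & G1 & G2 & _).
    destruct (IHE (splitX d) (split1 d) (splitl d m)) as [u R1]; auto.
    { assert (Z := slow_le (tracks_slow Tl) m); lia. }
    { unfold occurs; congruence. }
    destruct (IHF (splitZ d) (split2 d) (splitr d m)) as [v R2]; auto.
    { assert (Z := slow_le (tracks_slow Tr) m); lia. }
    { unfold occurs; congruence. }
    exists (par_state u v); eapply resolves_par; eauto.
  - destruct (the_res_split_spec J H0) as [D J1].
    destruct (decomp_unary_Some D H0) as (s1 & K1 & K); inversion K; subst.
    destruct (decomp_unary_Some D Hs) as (t1 & G1 & _).
    destruct (IH (res_hset c Y) (the_res_split c Y p) m) as [u R]; auto.
    { unfold occurs; congruence. }
    exists (res_state c u); eapply resolves_res; eauto.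
  - destruct (the_rel_split_spec J H0) as [D J1].
    destruct (decomp_unary_Some D H0) as (s1 & K1 & K); inversion K; subst.
    destruct (decomp_unary_Some D Hs) as (t1 & G1 & _).
    destruct (IH (rel_hset f Y) (the_rel_split f Y p) m) as [u R]; auto.
    { unfold occurs; congruence. }
    exists (rel_state f u); eapply resolves_rel; eauto. }
intros Y p J O.
destruct (proj1 (occurs_Some p 0) (proj1 (Y_just_path J))) as [[P|P a Q] H0]; eauto.
Qed.

(** All readings of all positions split along the same chosen components. *)
Lemma resolves_par_inv (Y : hset C) (p : sequence sstate) (P Q : expr) (n : nat) (w : ustate) :
  p 0 = Some (SExpr (Par P Q)) -> resolves Y p n w ->
  let d := the_par_split Y p in
  exists u v, w = par_state u v /\
    resolves (splitX d) (split1 d) (splitl d n) u /\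
    resolves (splitZ d) (split2 d) (splitr d n) v.
Proof.
intros H0 R; inversion R as [? ? s ? H N|? ? s ? ? H N|? ? ? ? d ? u v H Hd R1 R2|? ? ? ? ? ? H|? ? ? ? ? ? H];
  subst; rewrite H0 in H; try discriminate H.
- injection H as H; rewrite <- H in N; now destruct N.
- injection H as H; rewrite <- H in N; now destruct N.
- exists u, v; auto.
Qed.

Lemma resolves_res_inv (Y : hset C) (p : sequence sstate) (P : expr) (c : hs C) n (w : ustate) :
  p 0 = Some (SExpr (Res P c)) -> resolves Y p n w ->
  exists u, w = res_state c u /\ resolves (res_hset c Y) (the_res_split c Y p) n u.
Proof.
intros H0 R; inversion R as [? ? s ? H N|? ? s ? ? H N|? ? ? ? ? ? ? ? H|? ? ? c' ? u H R'|? ? ? ? ? ? H];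
  subst; rewrite H0 in H; try discriminate H.
- injection H as H; rewrite <- H in N; now destruct N.
- injection H as H; rewrite <- H in N; now destruct N.
- injection H as -> ->; eauto.
Qed.

Lemma resolves_rel_inv (Y : hset C) (p : sequence sstate) (P : expr) (f : relabelling B C) n (w : ustate) :
  p 0 = Some (SExpr (Rel P f)) -> resolves Y p n w ->
  exists u, w = rel_state f u /\ resolves (rel_hset f Y) (the_rel_split f Y p) n u.
Proof.
intros H0 R; inversion R as [? ? s ? H N|? ? s ? ? H N|? ? ? ? ? ? ? ? H|? ? ? ? ? ? H|? ? ? f' ? u H R'];
  subst; rewrite H0 in H; try discriminate H.
- injection H as H; rewrite <- H in N; now destruct N.
- injection H as H; rewrite <- H in N; now destruct N.
- injection H as -> ->; eauto.
Qed.

(** * Just paths resolve to fair paths *)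

Lemma conc_target_composed (x y : deriv) : conc x y -> composed (SExpr (target y)).
(* The base clauses of [conc] concern parallel compositions, and a step out of a sum or an agent
   identifier discards that outer context. *)
Proof. intros H; induction H; simpl; auto. Qed.

(** Each position may use its own resolution, so the property passes to components and suffixes
    without lifting a whole path. *)
Definition persists (Y : hset C) (p : sequence sstate) (N : nat) (t : deriv) : Prop :=
  forall n, N <= n -> occurs p n -> exists u, resolves Y p n u /\ enab t u.

Definition blocked (t : deriv) : Prop :=
  forall Y p N, Y_just defn Y p -> occurs p N -> persists Y p N t ->
  exists h, label t = Hs B h /\ Y h.

Definition child (t' t : deriv) : Prop :=
  match t with
  | DPar x y => t' = x \/ t' = y
  | DParL x _ | DParR _ x | DRes x _ | DRel x _ => t' = x
  | _ => False
  end.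

(** The inversion lemmas for [enab] push a transition that persists in a composition into its chosen
    components, where the children of [t] persist and are blocked. *)
Lemma blocked_composed (t : deriv) : (forall t', child t' t -> blocked t') ->
  forall Y p N s, Y_just defn Y p -> p 0 = Some s -> composed s -> occurs p N ->
  persists Y p N t -> exists h, label t = Hs B h /\ Y h.
Proof.
intros IH Y p N s J H0 Cs O H.
destruct (H N (le_n N) O) as (w & R & E); assert (O' := O); apply occurs_Some in O'.
destruct O' as [sN HN].
destruct s as [P|]; [|contradiction]; destruct P as [| | |P Q|P c|P f|]; try contradiction.
- assert (S := the_par_split_spec J H0).
  destruct (resolves_par_inv H0 R) as (u & v & -> & R1 & R2).
  set (d := the_par_split Y p) in *.
  destruct S as (Tl & Tr & D & J1 & J2 & KY & KD).
  destruct (D _ _ HN) as (s1 & s2 & G1 & G2 & _).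
  assert (O1 : occurs (split1 d) (splitl d N)) by (unfold occurs; congruence).
  assert (O2 : occurs (split2 d) (splitr d N)) by (unfold occurs; congruence).
  (* Every component position from [l N] on is visited at some position from [N] on: if an earlier
     visit exists, monotonicity forces the position to be [l N] itself. *)
  assert (cover : forall p1 l, tracks p p1 l -> forall m, l N <= m -> occurs p1 m ->
    exists n, N <= n /\ occurs p n /\ l n = m).
  { intros p1 l T m Lm Om; destruct T as (T0 & T1 & T2); destruct (T2 _ Om) as (n & On & En).
    destruct (PeanoNat.Nat.le_ge_cases N n) as [Ln|Ln]; [eauto|].
    exists N; repeat split; auto; assert (Z := slow_mono (conj T0 T1) Ln); lia. }
  assert (P1 : forall t1, (forall u v, enab t (par_state u v) -> enab t1 u) ->
    persists (splitX d) (split1 d) (splitl d N) t1).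
  { intros t1 K m Lm Om; destruct (cover _ _ Tl m Lm Om) as (n & Ln & On & <-).
    destruct (H n Ln On) as (w & R' & E'); destruct (resolves_par_inv H0 R') as (u' & v' & -> & R1' & _).
    eauto. }
  assert (P2 : forall t2, (forall u v, enab t (par_state u v) -> enab t2 v) ->
    persists (splitZ d) (split2 d) (splitr d N) t2).
  { intros t1 K m Lm Om; destruct (cover _ _ Tr m Lm Om) as (n & Ln & On & <-).
    destruct (H n Ln On) as (w & R' & E'); destruct (resolves_par_inv H0 R') as (u' & v' & -> & _ & R2').
    eauto. }
  assert (inv := fun u v => @enab_par_inv t u v).
  destruct (enab_par_inv E) as [(t1 & -> & E1)|[(t2 & -> & E2)|(t1 & t2 & h & -> & E1 & E2 & L1 & L2)]].
  + destruct (IH t1 eq_refl _ _ _ J1 O1) as (h & L & Xh); [|simpl; eauto].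
    apply P1; intros u' v' E'.
    destruct (inv _ _ E') as [(t' & K & ?)|[(t' & K & _)|(? & ? & ? & K & _)]];
      [injection K as ->; auto|discriminate..].
  + destruct (IH t2 eq_refl _ _ _ J2 O2) as (h & L & Xh); [|simpl; eauto].
    apply P2; intros u' v' E'.
    destruct (inv _ _ E') as [(t' & K & ?)|[(t' & K & ?)|(? & ? & ? & K & _)]];
      [discriminate|injection K as ->; auto|discriminate].
  + assert (I : forall u v, enab (DPar t1 t2) (par_state u v) -> enab t1 u /\ enab t2 v).
    { intros u' v' E'.
      destruct (inv _ _ E') as [(t' & K & ?)|[(t' & K & ?)|(? & ? & ? & K & ? & ? & _)]];
        [discriminate..|injection K as -> ->; auto]. }
    destruct (IH t1 (or_introl eq_refl) _ _ _ J1 O1) as (h1 & M1 & Xh); [apply P1; apply I|].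
    destruct (IH t2 (or_intror eq_refl) _ _ _ J2 O2) as (h2 & M2 & Zh); [apply P2; apply I|].
    (* A persistent synchronisation would put [h] in [X] and its complement in [Z], which justness
       keeps apart. *)
    exfalso; apply (KD h); split; congruence.
- destruct (the_res_split_spec J H0) as [D J1].
  destruct (resolves_res_inv H0 R) as (u & -> & R1).
  destruct (enab_res_inv E) as (t1 & -> & E1 & N1 & N2).
  destruct (decomp_unary_Some D HN) as (s1 & G1 & _).
  destruct (IH t1 eq_refl _ _ N J1) as (h & L & [Yh|[ -> | -> ]]); [unfold occurs; congruence| |eauto|tauto|tauto].
  intros n Ln On; assert (On' : occurs p n).
  { destruct D as [_ D]; specialize (D n); unfold occurs in *.
    destruct (p n); [discriminate|]; destruct (the_res_split c Y p n); tauto. }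
  destruct (H n Ln On') as (w & R' & E'); destruct (resolves_res_inv H0 R') as (u' & -> & R1').
  destruct (enab_res_inv E') as (t' & K & E1' & _); injection K as ->; eauto.
- destruct (the_rel_split_spec J H0) as [D J1].
  destruct (resolves_rel_inv H0 R) as (u & -> & R1).
  destruct (enab_rel_inv E) as (t1 & -> & E1).
  destruct (decomp_unary_Some D HN) as (s1 & G1 & _).
  destruct (IH t1 eq_refl _ _ N J1) as (h & L & Yh);
    [unfold occurs; congruence| |exists (rel_hs f h); simpl; now rewrite L].
  intros n Ln On; assert (On' : occurs p n).
  { destruct D as [_ D]; specialize (D n); unfold occurs in *.
    destruct (p n); [discriminate|]; destruct (the_rel_split f Y p n); tauto. }
  destruct (H n Ln On') as (w & R' & E'); destruct (resolves_rel_inv H0 R') as (u' & -> & R1').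
  destruct (enab_rel_inv E') as (t' & K & E1'); injection K as ->; eauto.
Qed.

Lemma resolves_later_inv (Y : hset C) (p : sequence sstate) s (n : nat) (u : ustate) :
  p 0 = Some s -> ~ composed s -> resolves Y p (1 + n) u -> resolves Y (suffix 1 p) n u.
Proof.
intros H0 N R; inversion R as [|? ? ? ? ? H N' R'|? ? ? ? ? ? ? ? H|? ? ? ? ? ? H|? ? ? ? ? ? H];
  subst; auto; rewrite H0 in H; injection H as ->; exfalso; now apply N.
Qed.

Lemma persists_suffix (Y : hset C) (p : sequence sstate) (N : nat) (s : sstate) (t : deriv) :
  p 0 = Some s -> ~ composed s -> persists Y p (1 + N) t -> persists Y (suffix 1 p) N t.
Proof.
intros H0 Ns H n L O; destruct (H (1 + n)) as (u & R & E); [lia|exact O|].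
exists u; split; auto; eapply resolves_later_inv; eauto.
Qed.

Lemma persists_le (Y : hset C) (p : sequence sstate) (N M : nat) (t : deriv) :
  N <= M -> persists Y p N t -> persists Y p M t.
Proof. intros L H n Ln; apply H; lia. Qed.

(** Induction on [N] drops initial states until the path starts at a composed expression or
    persistence holds from the start. In the latter case one surviving step leads to a composed
    expression, unless the path has ended. *)
Lemma blocked_step (t : deriv) : (forall t', child t' t -> blocked t') -> blocked t.
Proof.
intros IH Y p N; revert p; induction N as [|N IHN]; intros p J O H;
  assert (Hp := Y_just_path J); destruct Hp as (P0 & P1 & P2 & P3);
  destruct (proj1 (occurs_Some p 0) P0) as [s H0];
  (destruct (classic (composed s)) as [Cs|Cs]; [now apply (blocked_composed IH J H0 Cs O)|]).
(* A path starting in a transition: [t] is concurrent with it, so its target is composed and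
   [blocked_composed] applies to the next suffix. *)
- assert (trans : forall p' P a Q, Y_just defn Y p' -> p' 0 = Some (STrans P a Q) ->
    persists Y p' 0 t -> exists h, label t = Hs B h /\ Y h).
  { intros p' P a Q J' H0' H'; assert (Hp := Y_just_path J'); destruct Hp as (Q0 & Q1 & Q2 & Q3).
    destruct (H' 0 (le_n 0) Q0) as (u & R & E).
    destruct (resolves_hat R J' H0') as [Eu Vu].
    destruct u as [|z]; [discriminate|].
    destruct (p' 1) as [s1|] eqn:H1; [|destruct (Q3 _ _ H0' H1); discriminate].
    assert (Ed := Q2 _ _ _ H0' H1); inversion Ed; subst.
    assert (Os : occurs p' 1) by (unfold occurs; congruence).
    apply (blocked_composed IH (Y_just_suffix J' Os) (N := 0) (s := SExpr Q)); auto.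
    - injection Eu as -> -> ->; destruct E as (x & _ & _ & K); exact (conc_target_composed K).
    - eapply persists_suffix; eauto. eapply persists_le; [|exact H']; lia. }
  destruct s as [P|P a Q]; [|eapply trans; eauto].
  destruct (p 1) as [s1|] eqn:H1.
  + assert (Ed := P2 _ _ _ H0 H1); inversion Ed; subst.
    assert (Os : occurs p 1) by (unfold occurs; congruence).
    apply (trans (suffix 1 p) P a Q (Y_just_suffix J Os) H1).
    eapply persists_suffix; eauto; eapply persists_le; [|exact H]; lia.
  (* The path ends in its first state, where the finite clause of justness restricts the labels. *)
  + destruct (H 0 (le_n 0) P0) as (u & R & E).
    destruct (resolves_hat R J H0) as [Eu Vu]; destruct u as [P'|]; [|discriminate].
    injection Eu as ->; destruct E as (x & Dx & <- & Sx).
    apply eqd_dom_valid in Dx; destruct Dx as [Vx Nx].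
    destruct (jf_finite (proj1 (Y_just_largest defn)) J H0 H1 (a := label x) (Q := target x))
      as [(h & Lh & Yh)|Rx]; [| |contradiction].
    * exists x; rewrite <- Sx; now apply valid_derives.
    * exists h; now rewrite label_canon.
- assert (Os : occurs p 1) by (apply (occurs_le P1 (n := 1) (m := 1 + N)); [lia|exact O]).
  apply (IHN (suffix 1 p)); [now apply Y_just_suffix|exact O|].
  eapply persists_suffix; eauto.
Qed.

Lemma all_blocked (t : deriv) : blocked t.
Proof.
induction t; apply blocked_step; simpl; intros t' Ht; try contradiction;
  [destruct Ht|..]; subst; auto.
Qed.

Lemma Y_just_fair (Y : hset C) (p : sequence sstate) : Y_just defn Y p -> fair_just Y p.
Proof.
intros J.
assert (ex : forall n, exists o, match p n, o with
  | Some s, Some u => resolves Y p n u /\ hat u = s /\ valid_state u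
  | None, None => True | _, _ => False end).
{ intros n; destruct (p n) as [s|] eqn:Hs; [|now exists None].
  destruct (@resolves_total n Y p J) as [u R]; [unfold occurs; congruence|].
  exists (Some u); split; auto; destruct (resolves_hat R J Hs); auto. }
set (q n := epsilon (inhabits None) (fun o => match p n, o with
  | Some s, Some u => resolves Y p n u /\ hat u = s /\ valid_state u
  | None, None => True | _, _ => False end)).
assert (Hq : forall n, match p n, q n with
  | Some s, Some u => resolves Y p n u /\ hat u = s /\ valid_state u
  | None, None => True | _, _ => False end) by (intros n; apply epsilon_spec, ex).
clearbody q.
assert (E : p = hat_path q).
{ apply functional_extensionality; intros n; unfold hat_path; specialize (Hq n).
  destruct (p n), (q n); simpl; try contradiction; auto; f_equal; symmetry; tauto. }
assert (Q : forall n u, q n = Some u -> resolves Y p n u /\ valid_state u /\ p n = Some (hat u)).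
{ intros n u Hu; specialize (Hq n); rewrite Hu in Hq; destruct (p n); [|contradiction].
  destruct Hq as (R & <- & V); auto. }
assert (O : forall n, occurs q n <-> occurs p n).
{ intros n; unfold occurs; rewrite E; unfold hat_path; destruct (q n); simpl; split; congruence. }
assert (Hp := Y_just_path J); destruct Hp as (P0 & P1 & P2 & P3).
exists q; split; [|split; [exact E|]].
- repeat split.
  + now apply O.
  + intros n; rewrite !O; auto.
  + intros n u v Hu Hv; destruct (Q _ _ Hu) as (_ & Vu & Pu), (Q _ _ Hv) as (_ & Vv & Pv).
    (* The resolutions were chosen separately for each position, but edges of U depend only on
       sources and targets, which [hat] retains. *)
    assert (Ed := P2 _ _ _ Pu Pv); destruct u as [P|x], v as [P'|y]; simpl in *; inversion Ed; subst;
      constructor; now apply is_derivation_valid.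
  + intros n u Hu Hn; destruct (Q _ _ Hu) as (_ & _ & Pu).
    destruct (P3 _ _ Pu) as [P HP].
    * rewrite E; unfold hat_path; now rewrite Hn.
    * destruct u as [P'|x]; [now exists P'|discriminate].
- intros t (N & ON & H); apply (@all_blocked t Y p N J); [now apply O|].
  intros n Ln On; apply O, occurs_Some in On; destruct On as [u Hu].
  exists u; split; [apply (Q _ _ Hu)|eauto].
Qed.

(** * Temporal formulas *)

Lemma eventually_always_persistent (x : deriv) (nu : deriv -> Prop) (q : sequence ustate) :
  eqd_dom x -> (forall y, nu y <-> eqd defn x y) ->
  ltl_F (ltl_G (ltl_atom (enabled defn nu))) q <-> persistent (canon x) q.
Proof.
intros Dx Hnu.
assert (en : forall u, enabled defn nu u <-> enab (canon x) u).
{ intros [P|z]; simpl; split; intros (y & K).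
  - destruct K as [K ->]; apply Hnu, eqd_iff_canon in K; exists y; intuition.
  - destruct K as (Dy & E & <-); exists y; rewrite Hnu, eqd_iff_canon; intuition.
  - destruct K as [K L]; apply Hnu, eqd_iff_canon in K; exists y; intuition.
  - destruct K as (Dy & E & L); exists y; rewrite Hnu, eqd_iff_canon; intuition. }
split.
- intros (N & O & H); exists N; split; auto; intros n u L Hu.
  assert (E : N + (n - N) = n) by lia.
  destruct (H (n - N)) as (v & Hv & Ev).
  + unfold occurs, suffix; rewrite E; congruence.
  + unfold suffix in Hv; rewrite <- plus_n_O, E in Hv; apply en; congruence.
- intros (N & O & H); exists N; split; auto; intros n On.
  apply occurs_Some in On; destruct On as [u Hu]; exists u; split.
  + unfold suffix in *; now rewrite <- plus_n_O.
  + apply en, (H (N + n)); [lia|exact Hu].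
Qed.

Lemma non_blocking_fairness (q : sequence ustate) :
  (forall nu, abstract_transition defn nu ->
     (exists a, abs_label nu a /\ non_blocking a) ->
     ltl_imp (ltl_F (ltl_G (ltl_atom (enabled defn nu))))
             (ltl_G (ltl_F (ltl_atom (holds_abs nu)))) q) <->
  fair (fun _ => True) q.
Proof.
split.
- intros F t Pt.
  assert (K : exists x, eqd_dom x /\ canon x = t).
  { destruct Pt as (N & O & H); apply occurs_Some in O; destruct O as [u Hu].
    destruct (H _ _ (le_n N) Hu) as (x & Dx & Ex & _); eauto. }
  destruct K as (x & Dx & <-).
  assert (Dx' := Dx); apply eqd_dom_valid in Dx'; destruct Dx' as [Vx Nx].
  rewrite (label_canon Vx).
  apply NNPP; intros Nh; assert (Nb : non_blocking (label x)).
  { destruct (label x) as [b [] |h|]; [left; now exists b| |exfalso; eauto|now right].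
    exfalso; apply Nx; now exists b. }
  (* The formula is used for the class of [x] itself. *)
  assert (Hx : forall y, eqd defn x y <-> eqd defn x y) by tauto.
  assert (GF : ltl_G (ltl_F (ltl_atom (holds_abs (eqd defn x)))) q).
  { apply F.
    - now exists x.
    - exists (label x); split; auto; exists x; split; auto; now apply eqd_refl.
    - now apply (eventually_always_persistent q Dx Hx). }
  (* An occurrence [z] of the class after [N] would be concurrent with a representative of its own
     class. *)
  destruct Pt as (N & O & Pt); destruct (GF N O) as (m & Om & u & Hu & Eu).
  unfold suffix in Hu; rewrite <- plus_n_O in Hu.
  destruct u as [|z]; [contradiction|].
  simpl in Eu; apply eqd_iff_canon in Eu; destruct Eu as (_ & _ & Ez).
  assert (L : N <= N + m) by lia.
  destruct (Pt (N + m) _ L Hu) as (y & Dy & Ey & Cy).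
  apply (conc_canon_neq Cy Dy); congruence.
(* Fairness gives a persistent transition a handshake label, so the premise of the implication fails
   for a non-blocking one. *)
- intros F nu (x & Dx & Hnu) (a & (y & Ny & <-) & Nb) H; exfalso.
  apply (eventually_always_persistent q Dx Hnu) in H.
  destruct (F _ H) as (h & Lh & _).
  apply Hnu, eqd_iff_canon in Ny; destruct Ny as (_ & Dy & Ec).
  apply eqd_dom_valid in Dy.
  rewrite Ec, (label_canon (proj1 Dy)) in Lh; rewrite Lh in Nb.
  destruct Nb as [[b Nb]|Nb]; discriminate.
Qed.

End Justness.

Theorem theorem3 (A B C : Type) (defn : A -> expr A B C)
    (Hguarded : forall X : A, guarded (defn X))
    (rho : sequence (sstate A B C)) (Hrho : is_spath defn rho) :
  just defn rho <->
  exists pi : sequence (ustate A B C),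
    is_upath defn pi /\
    rho = hat_path pi /\
    forall nu : deriv A B C -> Prop,
      abstract_transition defn nu ->
      (exists a : act B C, abs_label nu a /\ non_blocking a) ->
      ltl_imp (ltl_F (ltl_G (ltl_atom (enabled defn nu))))
              (ltl_G (ltl_F (ltl_atom (holds_abs nu)))) pi.
Proof.
split.
- intros (Y & J); destruct (Y_just_fair J) as (q & Hq & E & F).
  exists q; split; [exact Hq|split; [exact E|]].
  apply non_blocking_fairness; intros t Pt; destruct (F t Pt) as (h & L & _); eauto.
(* The formula leaves all handshakes unconstrained, so the path is just for the set of all
   handshakes. *)
- intros (q & Hq & E & F); exists (fun _ => True), (fair_just defn).
  split; [now apply fair_just_family|].
  exists q; split; [exact Hq|split; [exact E|]].
  now apply non_blocking_fairness.
Qed.
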